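(* Fix a real number $\alpha\ge\frac12$, a positive integer $k$, and a nonempty open subset $\Omega\subseteq\mathbb{R}^k$. Suppose $(\mathbb{R}^n,\cdot)$ is a Carnot group of step at most three (equipped with coordinates of the first or second kind with respect to some basis compatible with the stratification of its Lie algebra, and with the induced Carnot–Carathéodory metric) that is purely $k$-unrectifiable. Then there is no injective mapping in the class $C^{0,\alpha+}(\Omega;(\mathbb{R}^n,\cdot))$ that is also locally Lipschitz when considered as a map into Euclidean space $\mathbb{R}^n$.
   Context: **Carnot groups.** A Carnot group $G$ is a connected, simply connected, nilpotent Lie group whose Lie algebra has a fixed stratification $\mathfrak g=\mathfrak g_1\oplus\cdots\oplus\mathfrak g_r$, with $\mathfrak g_{j+1}=[\mathfrak g_1,\mathfrak g_j]$ for $1\le j\le r-1$ and $[\mathfrak g,\mathfrak g_r]=0$; $r$ is its step, $\mathfrak g_1$ its horizontal layer, $m_j=\dim\mathfrak g_j$. A basis $\{X^1,\ldots,X^n\}$ of $\mathfrak g$ is compatible with the stratification if $X^{h_{j-1}+1},\ldots,X^{h_j}$ is a basis of $\mathfrak g_j$ for each $j$, where $h_j=\sum_{i\le j}m_i$. **Coordinates.** $(\mathbb{R}^n,\cdot)$ denotes a Carnot group $G$ identified with $\mathbb{R}^n$ through a compatible basis in one of two ways. First kind: identify $\mathfrak g$ with $\mathbb{R}^n$ by the basis and use the group law $X\star Y=\exp^{-1}(\exp(X)\exp(Y))$. Second kind: use the group law $X\odot Y=\Phi^{-1}(\Phi(X)\Phi(Y))$, where $\Phi(a_1X^1+\cdots+a_nX^n)=\exp(a_1X^1)\cdots\exp(a_nX^n)$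 (a diffeomorphism $\mathfrak g\to G$). $\mathbb{R}^n$ alone denotes Euclidean space. **Carnot–Carathéodory metric.** Let $X^1,\ldots,X^{m_1}$ also denote the left-invariant vector fields on $(\mathbb{R}^n,\cdot)$ that agree at $0$ with the first $m_1$ coordinate vectors. The horizontal space at $p$ is $H_p(\mathbb{R}^n,\cdot)=\mathrm{span}\{X^1_p,\ldots,X^{m_1}_p\}$, with inner product making these vectors orthonormal. A path $\gamma:[a,b]\to\mathbb{R}^n$ is horizontal if it is absolutely continuous (Euclidean sense) and $\gamma'(t)\in H_{\gamma(t)}(\mathbb{R}^n,\cdot)$ for a.e. $t$; its length is $\int_a^b|\gamma'(t)|\,dt$ with respect to this inner product. $d_{cc}(p,q)$ is the infimum of lengths of horizontal paths from $p$ to $q$. $(\mathbb{R}^n,\cdot)$ is always equipped with $d_{cc}$. **Pure unrectifiability.** $(\mathbb{R}^n,\cdot)$ is purely $k$-unrectifiable if for every $A\subseteq\mathbb{R}^k$ and every Lipschitz map $f:A\to(\mathbb{R}^n,\cdot)$ one has $\mathcal H^k_{cc}(f(A))=0$, where $\mathcal H^k_{cc}$ is the $k$-dimensional Hausdorff measure of $d_{cc}$. **The class $C^{0,\alpha+}$.** For metric spaces $X,Y$ and $\alpha>0$, a map $f:X\to Y$ is of class $C^{0,\alpha+}(X;Y)$ if there is a homeomorphism $\beta:[0,\infty)\to[0,\infty)$ with $d_Y(f(a),f(b))\le d_X(a,b)^\alpha\,\beta(d_X(a,b))$ for all $a,b\in X$. Here $\Omega$ carries the Euclidean metric. *)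

(* Defs.v *)
From mathcomp Require Import all_boot all_order all_algebra.
From mathcomp Require Import all_classical all_reals all_analysis.

Set Implicit Arguments.
Unset Strict Implicit.
Unset Printing Implicit Defensive.

Import Order.TTheory GRing.Theory Num.Theory.
Import numFieldNormedType.Exports.

Local Open Scope classical_set_scope.
Local Open Scope ring_scope.

(* The library norm `|x| on row vectors is the max norm, hence this one. *)
Definition enorm (R : realType) (n : nat) (x : 'rV[R]_n) : R :=
  Num.sqrt (\sum_(i < n) x 0 i ^+ 2).

Definition evec (R : realType) (n : nat) (i : 'I_n) : 'rV[R]_n := delta_mx 0 i.

Definition lin_span (R : realType) (n : nat) (A : set 'rV[R]_n) :
    set 'rV[R]_n :=
  [set v | exists (N : nat) (c : 'I_N -> R) (u : 'I_N -> 'rV[R]_n),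
     (forall i, A (u i)) /\ v = \sum_(i < N) c i *: u i].

Definition iter_partial (R : realType) (n : nat) (s : seq 'I_n)
    (f : 'rV[R]_n -> R) : 'rV[R]_n -> R :=
  foldr (fun i g x => 'D_(evec R i) g x) f s.

Definition smooth (R : realType) (n m : nat) (F : 'rV[R]_n -> 'rV[R]_m) : Prop :=
  forall (j : 'I_m) (s : seq 'I_n),
    let g := iter_partial s (fun x => F x 0 j) in
    continuous g /\ forall (i : 'I_n) (x : 'rV[R]_n), derivable g x (evec R i).

(* The underlying manifold is R^n itself and the neutral element is 0. *)
Record is_lie_group (R : realType) (n : nat)
    (mul : 'rV[R]_n -> 'rV[R]_n -> 'rV[R]_n) (inv : 'rV[R]_n -> 'rV[R]_n) :
    Prop := IsLieGroup {
  lg_mulA : associative mul;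
  lg_mul0x : left_id 0 mul;
  lg_mulx0 : right_id 0 mul;
  lg_mulVx : left_inverse 0 inv mul;
  lg_mulxV : right_inverse 0 inv mul;
  lg_smooth_mul :
    smooth (fun z : 'rV[R]_(n + n) => mul (lsubmx z) (rsubmx z));
  lg_smooth_inv : smooth inv }.

(* Value at p of the left-invariant vector field equal to X at 0, that is, the
   differential at 0 of the left translation by p, applied to X. *)
Definition left_invariant (R : realType) (n : nat)
    (mul : 'rV[R]_n -> 'rV[R]_n -> 'rV[R]_n) (X p : 'rV[R]_n) : 'rV[R]_n :=
  'D_X (mul p) 0.

Definition vf_bracket (R : realType) (n : nat) (V W : 'rV[R]_n -> 'rV[R]_n)
    (p : 'rV[R]_n) : 'rV[R]_n :=
  'D_(V p) W p - 'D_(W p) V p.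

(* The bracket of the Lie algebra, identified with the tangent space at 0. *)
Definition lie_bracket (R : realType) (n : nat)
    (mul : 'rV[R]_n -> 'rV[R]_n -> 'rV[R]_n) (X Y : 'rV[R]_n) : 'rV[R]_n :=
  vf_bracket (left_invariant mul X) (left_invariant mul Y) 0.

(* exp X = g : there is a one-parameter subgroup with velocity X at time 0
   reaching g at time 1. *)
Definition is_exp (R : realType) (n : nat)
    (mul : 'rV[R]_n -> 'rV[R]_n -> 'rV[R]_n) (X g : 'rV[R]_n) : Prop :=
  exists gamma : R -> 'rV[R]_n,
    [/\ forall s t : R, gamma (s + t) = mul (gamma s) (gamma t),
        is_derive (0 : R) (1 : R) gamma X
      & gamma 1 = g].

(* The point with coordinates a is exp (a_1 X^1 + ... + a_n X^n), where X^i is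
   the i-th standard basis vector of the tangent space at 0. *)
Definition first_kind (R : realType) (n : nat)
    (mul : 'rV[R]_n -> 'rV[R]_n -> 'rV[R]_n) : Prop :=
  forall a : 'rV[R]_n, is_exp mul a a.

(* The point with coordinates a is exp (a_1 X^1) ... exp (a_n X^n). *)
Definition second_kind (R : realType) (n : nat)
    (mul : 'rV[R]_n -> 'rV[R]_n -> 'rV[R]_n) : Prop :=
  forall a : 'rV[R]_n, exists g : 'I_n -> 'rV[R]_n,
    (forall i, is_exp mul (a 0 i *: evec R i) (g i)) /\
    a = \big[mul/0]_(i < n) g i.

(* With dims = [:: m_1; ...; m_r], the 0-based index i belongs to the j-th
   layer (j >= 1) iff h_(j-1) <= i < h_j where h_j = m_1 + ... + m_j. *)
Definition in_layer (dims : seq nat) (j i : nat) : bool :=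
  (sumn (take j.-1 dims) <= i < sumn (take j dims))%N.

Definition layer (R : realType) (n : nat) (dims : seq nat) (j : nat) :
    set 'rV[R]_n :=
  [set v | forall i : 'I_n, ~~ in_layer dims j i -> v 0 i = 0].

(* The standard basis of the Lie algebra R^n is compatible with the
   stratification. *)
Record is_stratified (R : realType) (n : nat)
    (mul : 'rV[R]_n -> 'rV[R]_n -> 'rV[R]_n) (dims : seq nat) : Prop :=
  IsStratified {
  st_dims_gt0 : all (fun m => 0 < m)%N dims;
  st_dims_sum : sumn dims = n;
  st_bracket : forall j : nat, (1 <= j <= (size dims).-1)%N ->
    @layer R n dims j.+1 =
    lin_span [set lie_bracket mul X Y
             | X in @layer R n dims 1 & Y in @layer R n dims j];
  st_last : forall X Y : 'rV[R]_n, layer dims (size dims) Y ->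
    lie_bracket mul X Y = 0 }.

(* R^n is connected and simply connected, and the stratification makes the
   Lie algebra nilpotent, so these conditions are not repeated. *)
Record carnot_group (R : realType) (n : nat) := CarnotGroup {
  cg_mul : 'rV[R]_n -> 'rV[R]_n -> 'rV[R]_n;
  cg_inv : 'rV[R]_n -> 'rV[R]_n;
  cg_dims : seq nat;
  cg_lie : is_lie_group cg_mul cg_inv;
  cg_strat : is_stratified cg_mul cg_dims;
  cg_coords : first_kind cg_mul \/ second_kind cg_mul }.

Definition step (R : realType) (n : nat) (G : carnot_group R n) : nat :=
  size (cg_dims G).

(* c is the coefficient vector of v in the frame X^1_p, ..., X^(m_1)_p; the
   remaining coefficients of c are 0. *)
Definition is_hcoord (R : realType) (n : nat) (G : carnot_group R n)
    (p v c : 'rV[R]_n) : Prop :=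
  layer (cg_dims G) 1 c /\
  v = \sum_(i < n | in_layer (cg_dims G) 1 i)
        c 0 i *: left_invariant (cg_mul G) (evec R i) p.

Definition hspace (R : realType) (n : nat) (G : carnot_group R n)
    (p : 'rV[R]_n) : set 'rV[R]_n :=
  [set v | exists c, is_hcoord G p v c].

(* Norm on hspace G p making the frame orthonormal (junk value 0 outside
   hspace G p). *)
Definition hnorm (R : realType) (n : nat) (G : carnot_group R n)
    (p v : 'rV[R]_n) : R :=
  enorm (xget 0 [set c | is_hcoord G p v c]).

Definition abs_continuous (R : realType) (n : nat) (a b : R)
    (gamma : R -> 'rV[R]_n) : Prop :=
  forall e : R, 0 < e -> exists2 d : R, 0 < d &
    forall (N : nat) (s t : 'I_N -> R),
      (forall i, a <= s i /\ s i <= t i /\ t i <= b) ->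
      (forall i j, i != j -> t i <= s j \/ t j <= s i) ->
      \sum_(i < N) (t i - s i) < d ->
      \sum_(i < N) enorm (gamma (t i) - gamma (s i)) < e.

Definition horizontal_path (R : realType) (n : nat) (G : carnot_group R n)
    (a b : R) (gamma : R -> 'rV[R]_n) : Prop :=
  abs_continuous a b gamma /\
  {ae @lebesgue_measure R, forall t : R, a <= t <= b ->
     derivable gamma t 1 /\ hspace G (gamma t) (derive1 gamma t)}.

Definition path_length (R : realType) (n : nat) (G : carnot_group R n)
    (a b : R) (gamma : R -> 'rV[R]_n) : \bar R :=
  (\int[@lebesgue_measure R]_(t in `[a, b]) (hnorm G (gamma t) (derive1 gamma t))%:E)%E.

Definition d_cc (R : realType) (n : nat) (G : carnot_group R n)
    (p q : 'rV[R]_n) : \bar R :=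
  ereal_inf [set l | exists (a b : R) (gamma : R -> 'rV[R]_n),
    [/\ a <= b, horizontal_path G a b gamma, gamma a = p, gamma b = q
      & l = path_length G a b gamma]].

Definition d_eucl (R : realType) (n : nat) (x y : 'rV[R]_n) : \bar R :=
  (enorm (x - y))%:E.

Definition lipschitz_map (R : realType) (k : nat) (Y : Type)
    (dY : Y -> Y -> \bar R) (A : set 'rV[R]_k) (f : 'rV[R]_k -> Y) : Prop :=
  exists2 L : R, 0 <= L & forall x y, A x -> A y ->
    (dY (f x) (f y) <= (L * enorm (x - y))%:E)%E.

Definition locally_lipschitz_map (R : realType) (k : nat) (Y : Type)
    (dY : Y -> Y -> \bar R) (A : set 'rV[R]_k) (f : 'rV[R]_k -> Y) : Prop :=
  forall x, A x -> exists2 U : set 'rV[R]_k, nbhs x U &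
    lipschitz_map dY (A `&` U) f.

(* The singleton [set 0] makes the diameter of the empty set 0 instead of -oo. *)
Definition diameter (R : realType) (Y : Type) (dY : Y -> Y -> \bar R)
    (E : set Y) : \bar R :=
  ereal_sup ([set 0%E] `|` [set dY x y | x in E & y in E]).

Definition hausdorff_pre (R : realType) (Y : Type) (dY : Y -> Y -> \bar R)
    (k : nat) (delta : R) (E : set Y) : \bar R :=
  ereal_inf [set l | exists C : nat -> set Y,
    [/\ E `<=` \bigcup_j C j,
        forall j, (diameter dY (C j) <= delta%:E)%E
      & l = (\sum_(0 <= j <oo) diameter dY (C j) ^+ k)%E]].

(* k-dimensional Hausdorff measure (k >= 1), without normalizing constant. *)
Definition hausdorff (R : realType) (Y : Type) (dY : Y -> Y -> \bar R)
    (k : nat) (E : set Y) : \bar R :=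
  ereal_sup [set hausdorff_pre dY k delta E | delta in [set d : R | 0 < d]].

Definition purely_unrectifiable (R : realType) (n : nat)
    (G : carnot_group R n) (k : nat) : Prop :=
  forall (A : set 'rV[R]_k) (f : 'rV[R]_k -> 'rV[R]_n),
    lipschitz_map (d_cc G) A f -> hausdorff (d_cc G) k (f @` A) = 0%E.

Definition homeo_nonneg (R : realType) (beta : R -> R) : Prop :=
  exists beta' : R -> R,
    [/\ forall x, 0 <= x -> 0 <= beta x /\ beta' (beta x) = x,
        forall y, 0 <= y -> 0 <= beta' y /\ beta (beta' y) = y,
        {within `[0, +oo[, continuous beta}
      & {within `[0, +oo[, continuous beta'}].

Definition holder_plus (R : realType) (k : nat) (Y : Type)
    (dY : Y -> Y -> \bar R) (alpha : R) (A : set 'rV[R]_k)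
    (f : 'rV[R]_k -> Y) : Prop :=
  exists2 beta : R -> R, homeo_nonneg beta &
    forall a b, A a -> A b ->
      (dY (f a) (f b) <= (enorm (a - b) `^ alpha * beta (enorm (a - b)))%:E)%E.

(* Main.v *)
Require Import Defs.
From HB Require Import structures.
From mathcomp Require Import all_boot all_order all_algebra fingroup perm.
From mathcomp Require Import all_classical all_reals all_analysis.
From mathcomp Require Import measurable_realfun ring lra.
Import Order.TTheory GRing.Theory Num.Theory.
Import numFieldNormedType.Exports.
Local Open Scope classical_set_scope.
Local Open Scope ring_scope.

(** Two opposite facts collide.  On the one hand a map f as in the theorem is
    locally Lipschitz into the Carnot group, so pure unrectifiability makes the
    k-dimensional measure of the image of a small cube vanish.  On the other
    hand an injective continuous image of a k-dimensional cube cannot be so thin.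

    Lipschitz.  The left-invariant fields satisfy X^i(x) = e_i + O(|x|).  Hence a
    horizontal path of small length r issued from the identity stays within O(r)
    of it, and then drifts by only O(r^2) in the coordinates outside the first
    layer; by left invariance d_cc(p, q) < r forces the same bounds on p^-1 q,
    with constants independent of p (dcc_displacement).  For f in C^{0,1/2+} and
    two points at distance h this gives r^2 = o(h).  So at every point where the
    Euclidean Lipschitz curve g(t) = f(a + t(b - a)) is differentiable, the
    coordinates of g' outside the first layer, taken in the left-invariant frame,
    vanish (contact_hspace).  A Lipschitz curve is differentiable almost
    everywhere, hence g is a horizontal path; its length is O(|b - a|), and
    therefore f is Lipschitz for d_cc (lipschitz_dcc).

    Thinness.  On bounded sets the Euclidean distance is locally at most a
    constant times d_cc (dcc_eucl_local).  Since the image Q' of a cube is null, it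
    is covered by sets of Euclidean diameters s_j with sum of s_j^k as small as one
    likes.  The images of two opposite faces are disjoint compact sets because f is
    injective, so the normalised distances to the images of k faces define a
    Lipschitz map from Q' to the unit cube sending opposite faces into opposite
    faces.  By the Poincare-Miranda theorem (miranda) this map is onto.  But sets
    whose diameters have a small sum of k-th powers do not cover the unit cube
    (boxes_not_cover): contradiction (thick_embedding).

    Three classical facts are established on the way.  The Poincare-Miranda
    theorem comes from a cubical Sperner lemma of Kuhn (kuhn_cubical), proved by
    computing a cup product of 0-cochains modulo 2.  The almost everywhere
    differentiability of Lipschitz curves (rV_lipschitz_derivable_ae) comes from
    the Radon-Nikodym density of a Lebesgue-Stieltjes measure and Lebesgue's
    differentiation theorem.  The bound of the increment of an absolutely
    continuous function by the integral of the size of its derivative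
    (ac_estimate) comes from an induction along the interval. *)

(** * Kuhn's cubical lemma, by a mod 2 cup product *)

Lemma F2_addrr (a : 'F_2) : a + a = 0.
Proof. by case: a => [[|[|?]] ?] //; apply/val_inj. Qed.

Lemma bump_ge (m i : nat) : (m <= i)%N -> bump m i = i.+1.
Proof. by rewrite /bump => ->. Qed.
Lemma bump_lt (m i : nat) : (i < m)%N -> bump m i = i.
Proof. by move=> im; rewrite /bump leqNgt im. Qed.

(** The factors before position j of the Leibniz rule in [cup_leibniz].
    Omitting the vertex m doubles the step m.-1, which modulo 2 splits into two
    single steps; the resulting sum telescopes in m. *)
Lemma cup_front (a : nat -> nat -> 'F_2) (j : nat) :
  \sum_(0 <= m < j.+1)
     \prod_(0 <= i < j) (a i (bump m i.+1) + a i (bump m i)) =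
  \prod_(0 <= i < j) (a i i.+1 + a i i).
Proof.
elim: j => [|j IH]; first by rewrite big_nat1 !big_geq.
rewrite big_nat_recr //= [RHS]big_nat_recr //= -IH.
rewrite (eq_big_nat _ _
   (F2 := fun m => (\prod_(0 <= i < j) (a i (bump m i.+1) + a i (bump m i)))
                    * (a j j.+2 + a j j.+1))); last first.
  move=> m /andP[_ mj]; rewrite big_nat_recr //.
  by rewrite !(@bump_ge m) // (leq_trans _ (leqnSn _)).
rewrite -big_distrl IH big_nat_recr //= bump_ge // bump_lt //.
rewrite [X in _ + X * _](eq_big_nat _ _ (F2 := fun i => a i i.+1 + a i i)); last first.
  by move=> i /andP[_ ij]; rewrite !bump_lt // ltnW.
rewrite -mulrDr; congr (_ * _).
by rewrite addrACA F2_addrr add0r addrC.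
Qed.

(** The factors after position j of the Leibniz rule in [cup_leibniz];
    they telescope as in [cup_front]. *)
Lemma cup_back (a : nat -> nat -> 'F_2) (j k : nat) : (j < k)%N ->
  \sum_(j.+1 <= m < k.+1)
     \prod_(j.+1 <= i < k) (a i (bump m i) + a i (bump m i.-1)) =
  \prod_(j.+1 <= i < k) (a i i.+1 + a i i).
Proof.
elim: k => // t IH; rewrite ltnS leq_eqVlt => /orP[/eqP <-|jt].
  by rewrite big_nat1 !big_geq.
have {IH} := IH jt => IH.
have jt1 : (j.+1 <= t.+1)%N by exact: ltnW.
rewrite (big_nat_recr t.+1) // [RHS]big_nat_recr // -IH big_nat_recr //=.
rewrite [X in _ = X * _]big_nat_recr //= mulrDl -addrA; congr (_ + _).
  rewrite big_distrl /=; apply: eq_big_nat => m /andP[jm mt].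
  rewrite big_nat_recr //=; congr (_ * (a _ _ + a _ _)).
    by rewrite bump_ge // ltnW.
  have t0 : (0 < t)%N by exact: leq_trans jt.
  by rewrite bump_ge ?prednK // -ltnS prednK.
rewrite !big_nat_recr //=.
have -> : \prod_(j.+1 <= i < t) (a i (bump t.+1 i) + a i (bump t.+1 i.-1)) =
  \prod_(j.+1 <= i < t) (a i (bump t i) + a i (bump t i.-1)).
  apply: eq_big_nat => i /andP[ji it]; rewrite !bump_lt //;
    by rewrite ?(leq_ltn_trans (leq_pred _)) // ltnW // ltnS ltnW.
rewrite -mulrDr; congr (_ * _).
have t0 : (0 < t)%N by exact: leq_trans jt.
rewrite bump_ge // (@bump_lt t.+1) // (@bump_lt t t.-1) ?prednK //.
rewrite (@bump_lt t.+1 t.-1) ?(leq_ltn_trans (leq_pred _)) //.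
by rewrite addrACA F2_addrr addr0.
Qed.

Section Kuhn.
Variables (n' N : nat).
Notation n := n'.+1.
Local Notation vertex := ('I_n -> nat).

(** Vertices of the simplices of Kuhn's triangulation of the unit cube
    based at x: the permutation r gives the time r a at which the path from x to
    x + (1, ..., 1) makes its step in the direction a. *)
Definition kuhn_vertex (x : vertex) (r : 'S_n) (m : nat) : vertex :=
  fun a => (x a + (r a < m))%N.

(** The cup product of the coboundaries of the labels L i, in which the
    coboundary of L j is replaced by L j itself, on the simplex w. *)
Definition leibniz_face (L : nat -> vertex -> 'F_2) (j : nat)
    (w : nat -> vertex) : 'F_2 :=
  (\prod_(0 <= i < j) (L i (w i.+1) + L i (w i))) * L j (w j) *
  \prod_(j.+1 <= i < n) (L i (w i) + L i (w i.-1)).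

(** The coboundary of [leibniz_face] is the cup product of all the
    coboundaries, because coboundaries are cocycles; signs disappear modulo 2. *)
Lemma cup_leibniz (L : nat -> vertex -> 'F_2) (j : nat) (v : nat -> vertex) :
  (j < n)%N ->
  \prod_(0 <= i < n) (L i (v i.+1) + L i (v i)) =
  \sum_(0 <= m < n.+1) leibniz_face L j (fun i => v (bump m i)).
Proof.
move=> jn; rewrite [RHS](@big_cat_nat _ _ _ j.+1) //=; last exact: leqW.
rewrite [X in _ = X + _](eq_big_nat _ _ (F2 := fun m =>
   (\prod_(0 <= i < j) (L i (v (bump m i.+1)) + L i (v (bump m i)))) *
   (L j (v j.+1) * \prod_(j.+1 <= i < n) (L i (v i.+1) + L i (v i))))); last first.
  move=> m /andP[_ mj]; rewrite /leibniz_face -mulrA; congr (_ * (_ * _)).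
    by rewrite bump_ge.
  apply: eq_big_nat => i /andP[ji _].
  have i0 : (0 < i)%N by exact: leq_trans ji.
  have mi : (m < i)%N by exact: leq_trans mj ji.
  by rewrite !bump_ge ?prednK // -?[(_ <= i.-1)%N]ltnS ?prednK // ltnW.
rewrite -big_distrl /= (cup_front (fun i m => L i (v m))).
rewrite [X in _ = _ + X](eq_big_nat _ _ (F2 := fun m =>
   (\prod_(0 <= i < j) (L i (v i.+1) + L i (v i)) * L j (v j)) *
    \prod_(j.+1 <= i < n) (L i (v (bump m i)) + L i (v (bump m i.-1))))); last first.
  move=> m /andP[jm _]; rewrite /leibniz_face bump_lt //; congr (_ * _ * _).
  apply: eq_big_nat => i /andP[_ ij]; rewrite !bump_lt //.
    by exact: leq_trans ij (ltnW jm).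
  by exact: leq_ltn_trans ij jm.
rewrite -big_distrr /= (cup_back (fun i m => L i (v m))) //.
rewrite [LHS](@big_cat_nat _ _ _ j) //=; last exact: ltnW.
rewrite [X in _ * X = _]big_ltn //.
by rewrite mulrA mulrDr mulrDl !mulrA.
Qed.

Lemma leibniz_face_ext (L : nat -> vertex -> 'F_2) (j : nat) (w w' : nat -> vertex) :
  (j < n)%N -> (forall i, (i < n)%N -> w i = w' i) ->
  leibniz_face L j w = leibniz_face L j w'.
Proof.
move=> jn ww; rewrite /leibniz_face ww //; congr (_ * _ * _).
  apply: eq_big_nat => i /andP[_ ij].
  by rewrite !ww // ?(leq_ltn_trans _ jn) // ltnW.
apply: eq_big_nat => i /andP[_ i_n].
by rewrite !ww // (leq_ltn_trans (leq_pred _)).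
Qed.

(** Even and odd permutations are exchanged by the transposition, so
    the sum counts every value twice. *)
Lemma sum_perm_tperm_invariant (F : 'S_n -> 'F_2) (i j : 'I_n) : i != j ->
  (forall r, F (r * tperm i j)%g = F r) -> \sum_r F r = 0.
Proof.
move=> ij Finv; rewrite (bigID (fun r : 'S_n => odd_perm r)) /=.
rewrite [X in _ + X](reindex_inj (mulIg (tperm i j))) /=.
rewrite [X in _ + X](eq_big (fun r : 'S_n => odd_perm r) F).
- by rewrite F2_addrr.
- by move=> r; rewrite odd_permM odd_tperm ij addbT negbK.
- by move=> r _; exact: Finv.
Qed.

(** A facet that omits an inner vertex m lies in exactly two simplices of
    the same cube: those whose paths make the steps m.-1 and m in either order. *)
Lemma sum_inner_face (L : nat -> vertex -> 'F_2) (j m : nat) (x : vertex) :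
  (0 < m < n)%N ->
  \sum_(r : 'S_n) leibniz_face L j (fun i => kuhn_vertex x r (bump m i)) = 0.
Proof.
move=> /andP[m0 mn]; have m1n : (m.-1 < n)%N by rewrite (leq_ltn_trans (leq_pred _)).
apply: (@sum_perm_tperm_invariant _ (Ordinal m1n) (Ordinal mn)).
  by rewrite -val_eqE /= neq_ltn prednK // leqnn.
move=> r; congr leibniz_face; apply/funext => i; apply/funext => a.
rewrite /kuhn_vertex permM; congr (_ + nat_of_bool _)%N.
have := neq_bump m i; set k := bump m i => mk.
have E : (m.-1 < k)%N = (m < k)%N by rewrite prednK // leq_eqVlt (negbTE mk).
by case: tpermP => [->|->|//] /=; rewrite E.
Qed.

(** Moves the first step of a path to its end, see [kuhn_vertexS]. *)
Definition ord_pred_perm : 'S_n := perm (can_inj (@ord_predK n)).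

Definition bump_at (b : 'I_n) (x : vertex) : vertex := fun a => (x a + (a == b))%N.

Lemma val_ord_pred (i : 'I_n) :
  ord_pred i = (if i == 0 :> nat then n' else i.-1) :> nat.
Proof.
case: i => [[|k] kn] /=; first by rewrite modn_small.
by rewrite modnDr modn_small // ltnW.
Qed.

(** A facet that omits the first vertex of a simplex of one cube omits the
    last vertex of a simplex of the next cube, in the direction of the first step. *)
Lemma kuhn_vertexS (x : vertex) (r : 'S_n) (i : nat) : (i < n)%N ->
  kuhn_vertex x r i.+1 =
  kuhn_vertex (bump_at ((r * ord_pred_perm)^-1%g ord_max) x) (r * ord_pred_perm)%g i.
Proof.
move=> i_n; apply/funext => a; rewrite /kuhn_vertex /bump_at -addnA; congr addn.
have -> : (a == ((r * ord_pred_perm)^-1)%g ord_max) = (r a == ord0).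
  have -> : forall (s : 'S_n) y, (a == (s^-1)%g y) = (s a == y).
    by move=> s y; apply/eqP/eqP => [->|<-]; rewrite ?permKV ?permK.
  rewrite permM permE.
  rewrite -!val_eqE [val (ord_pred _)]val_ord_pred /=.
  case: (nat_of_ord (r a)) (ltn_ord (r a)) => [|k] kn /=; first by rewrite eqxx.
  by rewrite ltn_eqF.
rewrite permM permE val_ord_pred -val_eqE /=.
case: (nat_of_ord (r a)) => [|k] //=.
by rewrite ltnNge -ltnS i_n.
Qed.

Hypothesis N0 : (0 < N)%N.

Section BoundaryValues.
Variables (L : nat -> vertex -> 'F_2) (c : nat -> 'F_2).
Hypothesis L0 : forall (i : 'I_n) x, x i = 0%N -> L i x = 0.
Hypothesis LN : forall (i : 'I_n) x, x i = N -> L i x = c i.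

(** On a face of the large cube orthogonal to b the label L b is
    constant, which kills the factor b of [leibniz_face]; if b is j, the factor
    L j itself vanishes. *)
Lemma face_boundary0 (j : nat) (x : vertex) (r : 'S_n) :
  (j < n)%N -> c j = 0 ->
  let b := (r^-1)%g ord_max in
  x b = 0%N \/ x b = N -> leibniz_face L j (kuhn_vertex x r) = 0.
Proof.
move=> jn cj b xb.
have vb i : (i < n)%N -> kuhn_vertex x r i b = x b.
  by move=> i_n; rewrite /kuhn_vertex /b permKV /= ltnNge -ltnS i_n addn0.
have Lb : forall i i', (i < n)%N -> (i' < n)%N ->
    L b (kuhn_vertex x r i) = L b (kuhn_vertex x r i').
  move=> i i' ? ?; case: xb => xb.
    by rewrite !L0 ?vb.
  by rewrite !LN ?vb.
rewrite /leibniz_face; case: (ltngtP b j) => bj.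
- rewrite (bigD1_seq (nat_of_ord b)) ?mem_index_iota ?iota_uniq //=.
  by rewrite (Lb b.+1 b) ?F2_addrr ?mul0r // (leq_ltn_trans bj).
- rewrite [X in _ * X](bigD1_seq (nat_of_ord b)) ?mem_index_iota ?iota_uniq ?bj //=.
  by rewrite (Lb b b.-1) ?F2_addrr ?mul0r ?mulr0 // (leq_ltn_trans (leq_pred _)).
- have -> : L j (kuhn_vertex x r j) = 0.
    rewrite -bj; case: xb => xb; first by rewrite L0 ?vb.
    by rewrite LN ?vb // bj.
  by rewrite mulr0 mul0r.
Qed.

(** The cup product of the coboundaries of the labels, evaluated on the
    fundamental chain of the cube with N subdivisions in every direction. *)
Definition cup_sum (L : nat -> vertex -> 'F_2) : 'F_2 :=
  \sum_(x : {ffun 'I_n -> 'I_N}) \sum_(r : 'S_n)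
    \prod_(0 <= i < n)
       (L i (kuhn_vertex (fun a => x a) r i.+1) + L i (kuhn_vertex (fun a => x a) r i)).

(** Cyclic shift of the coordinate b: the only term not matched on the
    nose lies on the two faces orthogonal to b, where F vanishes. *)
Lemma sum_shift (F : vertex -> 'F_2) (b : 'I_n) :
  (forall x, x b = 0%N \/ x b = N -> F x = 0) ->
  \sum_(x : {ffun 'I_n -> 'I_N}) F (bump_at b (fun a => x a)) =
  \sum_(x : {ffun 'I_n -> 'I_N}) F (fun a => x a).
Proof.
move=> F0.
pose sh (x : {ffun 'I_n -> 'I_N}) := [ffun a => if a == b then ordS (x a) else x a].
pose sh' (x : {ffun 'I_n -> 'I_N}) := [ffun a => if a == b then ord_pred (x a) else x a].
have shK : cancel sh sh'.
  by move=> x; apply/ffunP => a; rewrite !ffunE; case: eqP => // _; rewrite ordSK.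
rewrite [RHS](reindex_inj (can_inj shK)) /=; apply: eq_bigr => x _.
have [xb|xb] := ltnP (x b).+1 N.
  congr F; apply/funext => a; rewrite /bump_at ffunE.
  by case: eqP => [->|_] /=; rewrite ?addn0 // addn1 modn_small.
have {}xb : (x b).+1 = N by apply/eqP; rewrite eqn_leq xb ltn_ord.
rewrite !F0 //; first by left; rewrite ffunE eqxx /= xb modnn.
by right; rewrite /bump_at eqxx addn1.
Qed.

(** Stokes' theorem: by [cup_leibniz] the sum runs over the facets of
    all simplices; the inner ones cancel by [sum_inner_face], those between
    neighbouring cubes by [sum_shift], and those on the boundary vanish by
    [face_boundary0]. *)
Lemma cup_sum_boundary0 (j : nat) : (j < n)%N -> c j = 0 -> cup_sum L = 0.
Proof.
move=> jn cj; rewrite /cup_sum.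
pose V (x : {ffun 'I_n -> 'I_N}) := kuhn_vertex (fun a => x a).
under eq_bigr do under eq_bigr do
  rewrite (@cup_leibniz L j (kuhn_vertex _ _) jn).
under eq_bigr do rewrite exchange_big /= big_nat_recr // big_nat_recl //=.
rewrite (eq_bigr (fun x : {ffun 'I_n -> 'I_N} =>
  \sum_(r : 'S_n) leibniz_face L j
     (kuhn_vertex (bump_at ((r^-1)%g ord_max) (fun a => x a)) r) +
  \sum_(r : 'S_n) leibniz_face L j (kuhn_vertex (fun a => x a) r))); last first.
  move=> x _; rewrite [X in _ + X + _]big1_seq ?addr0; last first.
    move=> m; rewrite mem_index_iota => /andP[_ /andP[_ mn]].
    exact: sum_inner_face.
  congr (_ + _); last first.
    by apply: eq_bigr => r _; apply: leibniz_face_ext => // i i_n; rewrite bump_lt.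
  rewrite [RHS](reindex_inj (mulIg ord_pred_perm)) /=.
  apply: eq_bigr => r _; apply: leibniz_face_ext => // i i_n.
  by rewrite bump_ge // kuhn_vertexS.
rewrite big_split /= exchange_big [X in _ + X]exchange_big /=.
rewrite (eq_bigr (fun r : 'S_n => \sum_(x : {ffun 'I_n -> 'I_N})
    leibniz_face L j (kuhn_vertex (fun a => x a) r))) ?F2_addrr //.
move=> r _; apply: (sum_shift (fun x => leibniz_face L j (kuhn_vertex x r))).
by move=> x xb; apply: face_boundary0.
Qed.

End BoundaryValues.
End Kuhn.

Section KuhnLemma.
Variables (n' N : nat).
Notation n := n'.+1.
Local Notation vertex := ('I_n -> nat).
Hypothesis N0 : (0 < N)%N.

Definition boundary_normalized (L : nat -> vertex -> 'F_2) : Prop :=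
  (forall (i : 'I_n) x, x i = 0%N -> L i x = 0) /\
  (forall (i : 'I_n) x, x i = N -> L i x = 1).

(** The cup product is linear in the label j, and the difference of two
    admissible labels vanishes on both faces orthogonal to j. *)
Lemma cup_sum_exchange (L L' : nat -> vertex -> 'F_2) (j : nat) :
  boundary_normalized L -> boundary_normalized L' -> (j < n)%N ->
  (forall i, i != j -> L i = L' i) ->
  cup_sum n' N L = cup_sum n' N L'.
Proof.
move=> [L0 LN] [L'0 L'N] jn LL'; apply/eqP; rewrite -subr_eq0; apply/eqP.
have opp2 (a : 'F_2) : - a = a by apply/esym/eqP; rewrite -addr_eq0 F2_addrr.
rewrite opp2.
pose M i x := if i == j then L j x + L' j x else L i x.
rewrite -(@cup_sum_boundary0 n' N M (fun i => (i != j)%:R) _ _ j jn).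
- rewrite /cup_sum -big_split; apply: eq_bigr => x _ /=.
  rewrite -big_split; apply: eq_bigr => r _ /=.
  have jI : j \in index_iota 0 n by rewrite mem_index_iota.
  rewrite (bigD1_seq j) ?iota_uniq //= [X in _ + X](bigD1_seq j) ?iota_uniq //=.
  rewrite [RHS](bigD1_seq j) ?iota_uniq //= /M eqxx.
  rewrite (eq_bigr (fun i => L i (kuhn_vertex n' (fun a => x a) r i.+1) +
    L i (kuhn_vertex n' (fun a => x a) r i))); last by [].
  rewrite [X in _ + _ * X](eq_bigr (fun i => L i (kuhn_vertex n' (fun a => x a) r i.+1) +
    L i (kuhn_vertex n' (fun a => x a) r i))); last by move=> i ij; rewrite LL'.
  rewrite [X in _ = _ * X](eq_bigr (fun i => L i (kuhn_vertex n' (fun a => x a) r i.+1) +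
    L i (kuhn_vertex n' (fun a => x a) r i))); last by move=> i ij; rewrite (negbTE ij).
  by rewrite -mulrDl addrACA.
- move=> i x xi; rewrite /M; case: eqP => [ij|_]; last exact: L0.
  by rewrite -ij L0 // L'0 // addr0.
- move=> i x xi; rewrite /M; case: eqP => [ij|_]; last exact: LN.
  by rewrite -ij LN // L'N // F2_addrr.
- by rewrite eqxx.
Qed.

(** The simplest admissible labels; only one simplex, the one based at 0
    whose steps are made in the order of the indices, sees all of them jump. *)
Definition step_labels (i : nat) (x : vertex) : 'F_2 := (0 < x (inord i))%N%:R.

Lemma step_labels_normalized : boundary_normalized step_labels.
Proof. by split=> i x xi; rewrite /step_labels inord_val xi ?N0. Qed.

Lemma cup_sum_step_labels : cup_sum n' N step_labels = 1.
Proof.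
pose x0 : {ffun 'I_n -> 'I_N} := [ffun=> Ordinal N0].
have E (x : {ffun 'I_n -> 'I_N}) (r : 'S_n) :
    \prod_(0 <= i < n) (step_labels i (kuhn_vertex n' (fun a => x a) r i.+1) +
      step_labels i (kuhn_vertex n' (fun a => x a) r i)) =
    ((x == x0) && (r == 1%g))%:R.
  rewrite big_mkord (eq_bigr (fun i : 'I_n => ((x i == 0%N :> nat) && (r i == i))%:R)); last first.
    move=> i _; rewrite /step_labels /kuhn_vertex inord_val.
    case: (nat_of_ord (x i)) => [|k]; last by rewrite /= F2_addrr.
    rewrite !add0n !lt0b ltnS leq_eqVlt -val_eqE /=.
    by case: ltngtP => _; rewrite /= ?F2_addrr ?addr0.
  have [/andP[/eqP-> /eqP->]|] := boolP (_ && _).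
    by rewrite big1 // => i _; rewrite ffunE perm1 !eqxx.
  move=> xr; have [i xri] : exists i, ~~ ((x i == 0%N :> nat) && (r i == i)).
    apply/existsP; apply: contraR xr => /existsPn xr; apply/andP; split.
      apply/eqP/ffunP => i; apply/val_inj; rewrite ffunE /=.
      by have := xr i; rewrite negbK => /andP[/eqP].
    by apply/eqP/permP => i; rewrite perm1; have := xr i; rewrite negbK => /andP[_ /eqP].
  by rewrite (bigD1 i) //= (negbTE xri) mul0r.
rewrite /cup_sum (bigD1 x0) //= (bigD1 1%g) //= E !eqxx /=.
rewrite big1 ?addr0; last by move=> r r1; rewrite E eqxx (negbTE r1).
rewrite big1 ?addr0 // => x xx0; rewrite big1 // => r _.
by rewrite E (negbTE xx0).
Qed.

(** Replacing the labels one at a time by [step_labels] does not change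
    the sum. *)
Lemma cup_sum_normalized (L : nat -> vertex -> 'F_2) :
  boundary_normalized L -> cup_sum n' N L = 1.
Proof.
move=> Ln; rewrite -cup_sum_step_labels.
pose M t i := if (i < t)%N then step_labels i else L i.
have Mn t : boundary_normalized (M t).
  have [[? ?] [? ?]] := (Ln, step_labels_normalized).
  by split=> i x xi; rewrite /M; case: ifP; auto.
have MM t : (t <= n)%N -> cup_sum n' N (M t) = cup_sum n' N L.
  elim: t => [_|t IH tn]; first by congr cup_sum.
  rewrite -IH ?(ltnW tn) //; apply: (@cup_sum_exchange _ _ t) => // i it.
  by rewrite /M ltnS leq_eqVlt (negbTE it).
rewrite -(MM n) // /cup_sum; apply: eq_bigr => x _; apply: eq_bigr => r _.
by apply: eq_big_nat => i /andP[_ i_n]; rewrite /M i_n.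
Qed.

End KuhnLemma.

(** Kuhn's cubical Sperner lemma.  Since [cup_sum] is 1, some simplex has a
    nonzero cup product, which means that every label changes along one of its
    edges. *)
Lemma kuhn_cubical (n N : nat) (l : 'I_n -> ('I_n -> nat) -> bool) : (0 < N)%N ->
  (forall i x, x i = 0%N -> l i x = false) ->
  (forall i x, x i = N -> l i x = true) ->
  exists2 x : 'I_n -> nat, forall i, (x i < N)%N &
    forall i, exists p q : 'I_n -> nat,
      [/\ forall a, (x a <= p a <= (x a).+1)%N, forall a, (x a <= q a <= (x a).+1)%N,
          l i p = true & l i q = false].
Proof.
case: n l => [|n'] l N0 l0 lN; first by exists (fun=> 0%N) => -[].
pose L i x : 'F_2 := (l (inord i) x)%:R.
have Ln : boundary_normalized n' N L.
  by split=> i x xi; rewrite /L inord_val; [rewrite l0|rewrite lN].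
have := cup_sum_normalized _ _ N0 _ Ln.
set V := fun (x : {ffun 'I_n'.+1 -> 'I_N}) => kuhn_vertex n' (fun a => x a).
have [[x [r xr]] _|no] := pselect (exists x r, forall i : 'I_n'.+1,
    l i (V x r i.+1) != l i (V x r i)).
  exists (fun a => x a) => // i.
  have Vx m a : (x a <= V x r m a <= (x a).+1)%N.
    by rewrite /V /kuhn_vertex; case: (r a < m)%N; rewrite ?addn0 ?addn1 !leqnn leqnSn.
  have := xr i; case E1: (l i (V x r i.+1)); case E2: (l i (V x r i)) => // _.
    by exists (V x r i.+1), (V x r i).
  by exists (V x r i), (V x r i.+1).
rewrite /cup_sum big1 => [/eqP|x _]; first by rewrite eq_sym oner_eq0.
rewrite big1 // => r _.
have [i /negP] : exists i, ~ (l i (V x r i.+1) != l i (V x r i)).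
  by apply/not_existsP => xr; apply: no; exists x, r => i; apply: contrapT; exact: xr.
rewrite negbK => /eqP li.
rewrite (bigD1_seq (nat_of_ord i)) ?mem_index_iota ?iota_uniq //=.
by rewrite /L inord_val -/(V x r i.+1) li F2_addrr mul0r.
Qed.

(** * The Poincare-Miranda theorem and coverings of the unit cube *)

Section Cube.
Context {R : realType}.

Definition unit_cube (k : nat) : set 'rV[R]_k :=
  [set t | forall i, 0 <= t 0 i <= 1].

Lemma ler_rV_norm (n : nat) (x : 'rV[R]_n) (i : 'I_n) : `|x 0 i| <= `|x|.
Proof. by rewrite [leRHS]/Num.Def.normr/= mx_normrE; exact: (le_bigmax _ _ (ord0, i)). Qed.

Lemma rV_norm_le (n : nat) (x : 'rV[R]_n) (r : R) : 0 <= r ->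
  (forall i, `|x 0 i| <= r) -> `|x| <= r.
Proof.
move=> r0 xr; rewrite [leLHS]/Num.Def.normr/= mx_normrE.
by apply: bigmax_le => // -[i j] _; rewrite (ord1 i).
Qed.

(** Kuhn's lemma for the signs of the coordinates of G - c on a grid of
    mesh 1 / N yields a grid cube on which every coordinate changes sign. *)
Lemma miranda_approx (k : nat) (G : 'rV[R]_k -> 'rV[R]_k) (K : R) (c : 'rV[R]_k) :
  0 <= K ->
  (forall t s, unit_cube k t -> unit_cube k s -> `|G t - G s| <= K * `|t - s|) ->
  (forall t i, unit_cube k t -> t 0 i = 0 -> G t 0 i = 0) ->
  (forall t i, unit_cube k t -> t 0 i = 1 -> G t 0 i = 1) ->
  unit_cube k c ->
  forall e, 0 < e -> exists2 t, unit_cube k t & `|G t - c| <= e.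
Proof.
move=> K0 GK G0 G1 cC e e0.
pose N := (Num.truncn (K / e)).+1.
have NK : K / N%:R <= e.
  rewrite ler_pdivrMr // mulrC -ler_pdivrMr //; apply/ltW; exact: truncnS_gt.
have N0 : (0 < N)%N by [].
have NR : (0 : R) < N%:R by rewrite ltr0n.
(* Indices are truncated at N, so that every index denotes a point of the cube. *)
pose T (p : 'I_k -> nat) : 'rV[R]_k := \row_i ((minn (p i) N)%:R / N%:R).
have TC p : unit_cube k (T p).
  move=> i; rewrite mxE divr_ge0 //= ler_pdivrMr // mul1r ler_nat.
  exact: geq_minr.
(* The sign of the i-th coordinate of G - c, with the values that Kuhn's lemma
   prescribes on the two faces; they do not contradict the sign there. *)
pose l i p := (N <= p i)%N || ((0 < p i)%N && (c 0 i <= G (T p) 0 i)).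
have [||x xN xl] := @kuhn_cubical k N l N0.
- by move=> i x xi; rewrite /l xi.
- by move=> i x xi; rewrite /l xi leqnn.
have near p : (forall a, (x a <= p a <= (x a).+1)%N) -> `|G (T p) - G (T x)| <= e.
  move=> xp; apply: le_trans NK; apply: le_trans (GK _ _ (TC _) (TC _)) _.
  apply: ler_wpM2l => //; apply: rV_norm_le; first by rewrite invr_ge0 ltW.
  move=> i; rewrite !mxE -mulrBl normrM [X in _ * X]gtr0_norm ?invr_gt0 //.
  rewrite -[leRHS]mul1r ler_wpM2r ?invr_ge0 ?(ltW NR) //.
  have /andP[xi1 xi2] := xp i.
  rewrite -natrB; last by rewrite leq_min geq_minr (leq_trans (geq_minl _ _)).
  rewrite normr_nat (ler_nat _ _ 1) leq_subLR addn1.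
  rewrite (minn_idPl (ltnW (xN i))); exact: leq_trans (geq_minl _ _) _.
exists (T x) => //; apply: rV_norm_le; first exact: ltW.
move=> i; have [p [q [xp xq lp lq]]] := xl i.
have /(le_trans (ler_rV_norm _ _ i)) := near _ xp.
have /(le_trans (ler_rV_norm _ _ i)) := near _ xq.
rewrite !mxE.
have Gp : c 0 i <= G (T p) 0 i.
  move: lp; rewrite /l => /orP[Np|/andP[]//].
  rewrite G1 //; first by case/andP: (cC i).
  by rewrite mxE (minn_idPr Np) divff // gt_eqF.
have Gq : G (T q) 0 i <= c 0 i.
  move: lq; rewrite /l => /negbT; rewrite negb_or negb_and -ltnNge -leqNgt => /andP[qN].
  case/orP => [q0|]; last by rewrite -ltNge => /ltW.
  rewrite G0 //; first by case/andP: (cC i).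
  by move: q0; rewrite leqn0 mxE => /eqP ->; rewrite min0n mul0r.
rewrite !ler_norml; move: Gp Gq.
set a := G _ _ _; set b := G _ _ _; set d := G _ _ _; set cc := c _ _ => *.
by apply/andP; split; lra.
Qed.

Lemma unit_cube_compact (k : nat) : compact (unit_cube k).
Proof.
have := @rV_compact R k (fun=> `[0 : R, 1]%classic) (fun=> @segment_compact R 0 1).
congr compact; apply/seteqP; split=> t /= h i; have := h i; by rewrite in_itv.
Qed.

Lemma lipschitz_within_continuous (V W : normedModType R) (A : set V) (G : V -> W) (K : R) :
  0 <= K -> (forall t s, A t -> A s -> `|G t - G s| <= K * `|t - s|) ->
  {within A, continuous G}.
Proof.
move=> K0 GK; apply/subspace_continuousP => x Ax; apply/cvgrPdist_le => e e0.
rewrite /prop_near1 /within /=.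
have K1 : 0 < K + 1 by rewrite ltr_wpDl.
have d0 : 0 < e / (K + 1) by rewrite divr_gt0.
apply: filterS (nbhsx_ballx x _ d0) => y; rewrite -ball_normE /= => xy Ay.
apply: le_trans (GK _ _ Ax Ay) _; move/ltW: xy.
rewrite ler_pdivlMr // => /(le_trans _); apply.
by rewrite mulrC ler_wpM2l // lerDl.
Qed.

(** The infimum of the distance between G t and c is 0 by
    [miranda_approx], and it is attained by compactness. *)
Lemma miranda (k : nat) (G : 'rV[R]_k -> 'rV[R]_k) (K : R) (c : 'rV[R]_k) :
  0 <= K ->
  (forall t s, unit_cube k t -> unit_cube k s -> `|G t - G s| <= K * `|t - s|) ->
  (forall t i, unit_cube k t -> t 0 i = 0 -> G t 0 i = 0) ->
  (forall t i, unit_cube k t -> t 0 i = 1 -> G t 0 i = 1) ->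
  unit_cube k c ->
  exists2 t, unit_cube k t & G t = c.
Proof.
move=> K0 GK G0 G1 cC.
have [||t] := @compact_EVT_min _ R (fun t => `|G t - c|) (unit_cube k) _ (unit_cube_compact k).
- by exists c.
- apply: (@lipschitz_within_continuous _ _ _ _ K) => // t s tC sC.
  apply: le_trans (ler_dist_dist _ _) _.
  by rewrite opprB addrA subrK; exact: GK.
rewrite inE => tC tmin; exists t => //; apply/eqP; rewrite -subr_eq0 -normr_eq0.
rewrite eq_le normr_ge0 andbT; apply/ler_addgt0Pl => e e0; rewrite addr0.
have [s sC Gs] := miranda_approx k G K c K0 GK G0 G1 cC e e0.
by apply: le_trans Gs; apply: tmin; rewrite inE.
Qed.

Local Notation mu := (@lebesgue_measure R).

(** A volume argument in dimension k carried out with integrals over the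
    line only, by induction on k.  The predicate P selects the boxes that meet the
    slices chosen so far. *)
Lemma boxes_not_cover (k : nat) (P : nat -> bool) (lo hi : nat -> 'I_k -> R) (s : nat -> R) :
  (forall j, 0 <= s j) -> (forall j i, hi j i - lo j i <= s j) ->
  (\sum_(0 <= j <oo) (if P j then (s j ^+ k)%:E else 0) < 1)%E ->
  exists2 c : 'I_k -> R, (forall i, 0 <= c i <= 1) &
    forall j, P j -> exists i, ~~ (lo j i <= c i <= hi j i).
Proof.
elim: k P lo hi => [|k IH] P lo hi s0 hs sum1.
  exists (fun=> 0) => [[]//|j Pj]; exfalso; move: sum1; apply/negP; rewrite -leNgt.
  apply: (le_trans _ (nneseries_lim_ge j.+1 _)); last first.
    by move=> i _ _; case: ifP.
  rewrite big_nat_recr //= Pj expr0; apply: leeDr.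
  by apply: sume_ge0 => i _; case: ifP.
(* The mean of h over the unit interval is the sum for k.+1, so that h x < 1 for
   some x; fixing the first coordinate to be x leaves a problem in dimension k. *)
pose w j := if P j then s j ^+ k else 0.
have w0 j : 0 <= w j by rewrite /w; case: ifP => // _; exact: exprn_ge0.
pose I j : set R := `[lo j ord0, hi j ord0]%classic.
have mI j : measurable (I j) by exact: measurable_itv.
pose J : set R := `[0, 1]%classic.
have mJ : measurable J by exact: measurable_itv.
pose h (x : R) := (\sum_(0 <= j <oo) (w j * \1_(I j) x)%:E)%E.
have mwI j : measurable_fun J (fun x : R => (w j * \1_(I j) x)%:E).
  by apply/measurable_EFinP; apply: measurable_funM => //; exact: measurable_indic.
have wI0 j x : (0 <= (w j * \1_(I j) x)%:E)%E by rewrite lee_fin mulr_ge0.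
have [x x01 hx] : exists2 x : R, 0 <= x <= 1 & (h x < 1)%E.
  apply: contrapT => nohx.
  have h1 x : J x -> (1 <= h x)%E.
    rewrite /J /= in_itv /= => x01; rewrite leNgt; apply/negP => hx.
    by apply: nohx; exists x.
  have : (\int[mu]_(x in J) cst 1%E x <= \int[mu]_(x in J) h x)%E.
    apply: ge0_le_integral => //.
    by apply: ge0_emeasurable_sum => [j x _ _|j _ x]; [exact: wI0|exact: mwI].
  rewrite integral_cst //= mul1e /J lebesgue_measure_itv /= lte_fin ltr01 sube0.
  apply/negP; rewrite -ltNge; apply: le_lt_trans sum1.
  rewrite /h integral_nneseries //.
  apply: lee_nneseries => [j _ _|j _]; first exact: integral_ge0.
  under eq_integral do rewrite EFinM.
  have mIE : measurable_fun J (fun x => (\1_(I j) x)%:E : \bar R).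
    by apply/measurable_EFinP; exact: measurable_indic.
  rewrite ge0_integralZl_EFin //.
  rewrite integral_indic //; last exact: mI.
  rewrite /w; case: (P j); last first.
    by rewrite [X in (X * _)%E](_ : _ = 0%E) // mul0e.
  rewrite exprSr EFinM lee_wpmul2l ?lee_fin ?exprn_ge0 //.
  apply: (@le_trans _ _ (mu (I j))).
    by apply: le_measure; rewrite ?inE; [exact: measurableI (mI j) mJ|exact: mI|exact: subIsetl].
  rewrite /I lebesgue_measure_itv /=; case: (_ < _)%E; last by rewrite lee_fin.
  by rewrite -EFinB lee_fin.
have [||c c01 cP] := IH (fun j => P j && (x \in I j)) (fun j i => lo j (lift ord0 i))
     (fun j i => hi j (lift ord0 i)) s0.
- by move=> j i; exact: hs.
- apply: le_lt_trans hx; apply: lee_nneseries => [j _ _|j _].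
    by case: ifP => // _; rewrite lee_fin exprn_ge0.
  rewrite /w indicE; case: (P j); rewrite ?mul0r //=.
  by case: (x \in I j); rewrite ?mulr1 ?mulr0.
exists (fun i => if unlift ord0 i is Some i' then c i' else x).
  by move=> i; case: unliftP.
move=> j Pj; have [xI|xI] := boolP (x \in I j).
  have [|i' ci'] := cP j; first by rewrite Pj xI.
  by exists (lift ord0 i'); rewrite liftK.
exists ord0; rewrite unlift_none; apply: contra xI => xI.
by rewrite inE /I /= in_itv.
Qed.

(** The images by G of the sets E j lie in boxes of sides 2 * s j, which
    must cover the unit cube because G is onto. *)
Lemma thick_cover (k : nat) (G : 'rV[R]_k -> 'rV[R]_k) (K : R)
    (E : nat -> set 'rV[R]_k) (s : nat -> R) :
  0 <= K ->
  (forall t u, unit_cube k t -> unit_cube k u -> `|G t - G u| <= K * `|t - u|) ->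
  (forall t i, unit_cube k t -> t 0 i = 0 -> G t 0 i = 0) ->
  (forall t i, unit_cube k t -> t 0 i = 1 -> G t 0 i = 1) ->
  unit_cube k `<=` \bigcup_j E j ->
  (forall j, 0 <= s j) ->
  (forall j t u, unit_cube k t -> unit_cube k u -> E j t -> E j u ->
     `|G t - G u| <= s j) ->
  (1 <= \sum_(0 <= j <oo) ((2 * s j) ^+ k)%:E)%E.
Proof.
move=> K0 GK G0 G1 cov s0 Es; rewrite leNgt; apply/negP => sum1.
(* The image of E j by G lies in the box of radius s j around any of its points;
   an empty E j gets an irrelevant box. *)
pose T j := xget 0 (unit_cube k `&` E j).
have [|||c c01 cE] := boxes_not_cover k xpredT (fun j i => G (T j) 0 i - s j)
   (fun j i => G (T j) 0 i + s j) (fun j => 2 * s j).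
- by move=> j; rewrite mulr_ge0.
- by move=> j i; rewrite opprB addrC addrA subrK; lra.
- by [].
have [|t tC Gt] := miranda k G K (\row_i c i) K0 GK G0 G1.
  by move=> i; rewrite mxE.
have [j _ Ejt] := cov t tC.
have [TC ET] : (unit_cube k `&` E j) (T j) by apply: (@xgetPex _ 0); exists t.
have [i /negP] := cE j isT; apply.
have := le_trans (ler_rV_norm _ _ i) (Es j _ _ tC TC Ejt ET).
rewrite !mxE Gt mxE ler_norml; lra.
Qed.

End Cube.

Section Embedding.
Context {R : realType}.

Definition cube_face (k : nat) (i : 'I_k) (b : bool) : set 'rV[R]_k :=
  [set t | unit_cube k t /\ t 0 i = b%:R].

Lemma cube_face_neq0 (k : nat) (i : 'I_k) (b : bool) : cube_face k i b !=set0.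
Proof.
exists (const_mx b%:R); split => [j|]; rewrite mxE //.
by case: b; rewrite ?lexx ler01.
Qed.

Lemma cube_face_compact (k : nat) (i : 'I_k) (b : bool) : compact (cube_face k i b).
Proof.
pose A (j : 'I_k) : set R := if j == i then [set b%:R] else `[0, 1]%classic.
have cA j : compact (A j).
  by rewrite /A; case: ifP => _; [exact: compact_set1|exact: segment_compact].
have := @rV_compact R k A cA; congr compact; apply/seteqP; split => t /= At.
  split; last by have := At i; rewrite /A eqxx.
  move=> j; have := At j; rewrite /A; case: ifP => _ /=; last by rewrite in_itv.
  by move=> ->; case: (b); rewrite ?lexx ler01.
move=> j; rewrite /A; case: eqP => [->|_] /=; first exact: At.2.
by rewrite in_itv; exact: At.1.
Qed.

(** For an injective phi the images of opposite faces are at positive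
    distance, so that the truncated distances to the images of the faces turn phi
    into a map to which [thick_cover] applies, at the cost of a constant C. *)
Lemma thick_embedding (k n : nat) (phi : 'rV[R]_k -> 'rV[R]_n) (L : R) :
  0 <= L -> set_inj (unit_cube k) phi ->
  (forall t u, unit_cube k t -> unit_cube k u -> `|phi t - phi u| <= L * `|t - u|) ->
  exists2 C, 0 <= C & forall (E : nat -> set 'rV[R]_k) (s : nat -> R),
    unit_cube k `<=` \bigcup_j E j -> (forall j, 0 <= s j) ->
    (forall j t u, unit_cube k t -> unit_cube k u -> E j t -> E j u ->
       `|phi t - phi u| <= s j) ->
    (1 <= \sum_(0 <= j <oo) ((C * s j) ^+ k)%:E)%E.
Proof.
move=> L0 phi_inj phiL.
have minimizer (i : 'I_k) (b : bool) (h : 'rV[R]_k -> R) :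
    (forall t u, unit_cube k t -> unit_cube k u -> `|h t - h u| <= L * `|t - u|) ->
    exists T, cube_face k i b T /\ forall t, cube_face k i b t -> h T <= h t.
  move=> hL; have [||T] := @compact_EVT_min _ R h (cube_face k i b) _ (cube_face_compact k i b).
  - exact: cube_face_neq0.
  - by apply: (@lipschitz_within_continuous _ _ _ _ _ L) => // t u [tC _] [uC _]; exact: hL.
  by rewrite inE => TF Tmin; exists T; split => // t tF; apply: Tmin; rewrite inE.
have /choice[T TP] : forall iy : 'I_k * 'rV[R]_n, exists T, cube_face k iy.1 false T /\
    forall t, cube_face k iy.1 false t -> `|iy.2 - phi T| <= `|iy.2 - phi t|.
  move=> [i y]; apply: (minimizer i false (fun t => `|y - phi t|)) => t u tC uC.
  apply: le_trans (ler_dist_dist _ _) _.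
  by rewrite opprB addrC addrA subrK distrC; exact: phiL.
pose D i y := `|y - phi (T (i, y))|.
have DL i y z : `|D i y - D i z| <= `|y - z|.
  have key y' z' : D i y' - D i z' <= `|y' - z'|.
    rewrite lerBlDr; apply: le_trans ((TP (i, y')).2 _ (TP (i, z')).1) _.
    rewrite /= -(subrK z' y') -[y' - z' + z' - _]addrA (subrK z').
    exact: ler_normD.
  by rewrite ler_norml lerNl opprB [in X in X && _]distrC !key.
have /choice[U UP] : forall i, exists U, cube_face k i true U /\
    forall t, cube_face k i true t -> D i (phi U) <= D i (phi t).
  move=> i; apply: (minimizer i true (fun t => D i (phi t))) => t u tC uC.
  by apply: le_trans (DL _ _ _) _; exact: phiL.
pose d i := D i (phi (U i)).
have d0 i : 0 < d i.
  rewrite /d /D normr_gt0 subr_eq0; apply/eqP => E.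
  have [[UC U1] _] := UP i; have [[TC T0] _] := TP (i, phi (U i)).
  have E' : U i = T (i, phi (U i)) by apply: phi_inj; rewrite ?inE.
  by move: U1; rewrite E' T0 => /eqP; rewrite eq_sym oner_eq0.
(* D i is the distance to the image of the face of index i, and d i is its minimum
   over the image of the opposite face. *)
pose H (t : 'rV[R]_k) : 'rV[R]_k := \row_i Num.min 1 (D i (phi t) / d i).
pose C := \sum_i (d i)^-1.
have C0 : 0 <= C by apply: sumr_ge0 => i _; rewrite invr_ge0 ltW.
have HC t u : `|H t - H u| <= C * `|phi t - phi u|.
  apply: rV_norm_le => [|i]; first exact: mulr_ge0.
  have min1 (x y : R) : `|Num.min 1 x - Num.min 1 y| <= `|x - y|.
    have := ler_norm (x - y); have := ler_norm (y - x); rewrite (distrC y x) => yx xy.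
    by have [x1|x1] := leP 1 x; have [y1|y1] := leP 1 y; rewrite ler_norml;
      apply/andP; split; lra.
  rewrite !mxE; apply: le_trans (min1 _ _) _.
  rewrite -mulrBl normrM mulrC. apply: ler_pM => //.
  rewrite gtr0_norm ?invr_gt0 // /C (bigD1 i) //= lerDl.
  by apply: sumr_ge0 => j _; rewrite invr_ge0 ltW.
exists (2 * C); first exact: mulr_ge0.
move=> E s cov s0 Es.
have := @thick_cover R k H (C * L) E (fun j => C * s j).
under eq_eseriesr do rewrite mulrA.
apply => //.
- exact: mulr_ge0.
- by move=> t u tC uC; apply: le_trans (HC t u) _; rewrite -mulrA ler_wpM2l //; exact: phiL.
- move=> t i tC ti; rewrite mxE.
  suff -> : D i (phi t) = 0 by rewrite mul0r min_r ?ler01.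
  apply/eqP; rewrite -normr_le0 /D normr_id.
  apply: le_trans ((TP (i, phi t)).2 t _) _; first by split.
  by rewrite /= subrr normr0.
- move=> t i tC ti; rewrite mxE min_l // ler_pdivlMr // mul1r.
  by apply: (UP i).2; split.
- by move=> j; exact: mulr_ge0.
- by move=> j t u tC uC tE uE; apply: le_trans (HC t u) _; rewrite ler_wpM2l //; exact: Es.
Qed.

End Embedding.

(** * Increments of absolutely continuous functions *)

Section AbsoluteContinuity.
Context {R : realType}.
Local Notation mu := (@lebesgue_measure R).

(** Induction along [a, b]: the supremum of the points reached from a is
    reached, and cannot be smaller than b. *)
Lemma interval_induction (P : R -> Prop) (a b : R) : a <= b -> P a ->
  (forall s, a <= s <= b -> exists2 d, 0 < d &
     forall u v, a <= u -> s - d < u -> u <= s -> s <= v -> v < s + d -> v <= b ->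
       P u -> P v) ->
  P b.
Proof.
move=> ab Pa step; pose S := [set x | a <= x <= b /\ P x].
have Sa : S a by split => //; rewrite lexx.
have Sub : ubound S b by move=> x [/andP[]].
have Ss : has_sup S by split; [exists a|exists b].
set s := sup S; have as_ : a <= s by exact: sup_upper_bound.
have sb : s <= b by apply: ge_sup => //; exists a.
have [|d d0 Pd] := step s; first by rewrite as_ sb.
have [u [/andP[au ub] Pu] su] := sup_adherent d0 Ss.
have us : u <= s by apply: sup_upper_bound => //; split => //; rewrite au ub.
pose v := Num.min b (s + d / 2).
have sv : s <= v by rewrite le_min sb lerDl divr_ge0 ?ltW.
have vd : v < s + d by rewrite gt_min ltrD2l orbC ltr_pdivrMr // mulr_natr mulr2n ltrDl d0.
have vb : v <= b by rewrite ge_min lexx.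
have Pv := Pd u v au su us sv vd vb Pu.
have vs : v <= s.
  by apply: sup_upper_bound => //; split => //; rewrite (le_trans as_ sv).
move: Pv; rewrite /v; move: vs; rewrite /v /Num.min; case: ifP => // _.
by rewrite gerDl leNgt divr_gt0.
Qed.

Lemma derive_gt0_local (psi : R -> R) (s : R) :
  derivable psi s 1 -> 0 < 'D_1 psi s ->
  exists2 d, 0 < d & (forall v, s <= v -> v < s + d -> psi s <= psi v) /\
                     (forall u, s - d < u -> u <= s -> psi u <= psi s).
Proof.
move=> dpsi D0.
have /cvgrPdist_lt /(_ _ D0) := dpsi.
move=> -[d /= d0 dP].
exists d => //; split=> [v sv vd|u ud us].
  have [->//|vs] := eqVneq v s.
  have h0 : 0 < v - s by rewrite subr_gt0 lt_neqAle eq_sym vs.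
  have := dP (v - s); rewrite /ball_ /= sub0r normrN gtr0_norm // ltrBlDl => /(_ vd).
  rewrite gt_eqF // => /(_ isT); rewrite [_ *: 1]mulr1 subrK => /ltr_normlP[_].
  rewrite ltrBlDl -ltrBlDr subrr /GRing.scale /= => /ltW.
  by rewrite pmulr_rge0 ?invr_gt0 // subr_ge0.
have [->//|us'] := eqVneq u s.
have h0 : u - s < 0 by rewrite subr_lt0 lt_neqAle us' us.
have := dP (u - s); rewrite /ball_ /= sub0r normrN ltr0_norm // opprB ltrBlDl -ltrBlDr => /(_ ud).
rewrite lt_eqF // => /(_ isT); rewrite [_ *: 1]mulr1 subrK => /ltr_normlP[_].
rewrite ltrBlDl -ltrBlDr subrr /GRing.scale /= => /ltW.
by rewrite nmulr_rge0 ?invr_lt0 // subr_le0.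
Qed.

(** Absolute continuity of a scalar function, phrased as for paths so as to
    apply to coordinates and their compositions. *)
Definition ac_on (a b : R) (phi : R -> R) : Prop :=
  forall e : R, 0 < e -> exists2 d : R, 0 < d &
    forall (N : nat) (s t : 'I_N -> R),
      (forall i, a <= s i /\ s i <= t i /\ t i <= b) ->
      (forall i j, i != j -> t i <= s j \/ t j <= s i) ->
      \sum_(i < N) (t i - s i) < d ->
      \sum_(i < N) `|phi (t i) - phi (s i)| < e.

(** The function phi - F - e1 * id decreases locally at the points
    where the derivatives are known.  The other points form a null set, covered by
    an open set U of small measure, over which absolute continuity makes the total
    increment of phi small.  [interval_induction] assembles both estimates. *)
Lemma ac_monotone_estimate (phi F Df : R -> R) (a b : R) : a <= b -> ac_on a b phi ->
  {homo F : x y / x <= y} ->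
  {ae mu, forall t, derivable F t 1 /\ 'D_1 F t = Df t} ->
  {ae mu, forall t, a <= t <= b -> derivable phi t 1 /\ `|'D_1 phi t| <= Df t} ->
  phi b - phi a <= F b - F a.
Proof.
move=> ab acphi Fnd Fae phiae.
apply/ler_addgt0Pr => e e0.
pose e1 := e / 2 / (b - a + 1).
have ba1 : 0 < b - a + 1 by rewrite ltr_pwDr // subr_ge0.
have e10 : 0 < e1 by rewrite !divr_gt0.
have [d d0 acd] := acphi _ (divr_gt0 e0 (ltr0Sn R 1)).
have [B [mB B0 BP]] : mu.-negligible (~` [set t | (derivable F t 1 /\ 'D_1 F t = Df t) /\
   (a <= t <= b -> derivable phi t 1 /\ `|'D_1 phi t| <= Df t)]).
  apply: negligibleS (negligibleU Fae phiae) => t /= /not_andP[?|?]; by [left|right].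
have {}B0 : mu B = 0%E by exact: B0.
have [|U [oU BU Ud]] := @lebesgue_regularity_outer R B d mB _ d0.
  by apply: (@le_lt_trans _ _ 0%E); [rewrite le_eqVlt; apply/orP; left; apply/eqP; exact: B0|exact: ltry].
have mU : measurable U by exact: open_measurable.
have {}Ud : (mu U < d%:E)%E.
  rewrite -(setDUK BU); apply: (le_lt_trans (measureU2 mu mB _)).
    exact: measurableD.
  apply: (@le_lt_trans _ _ (0 + mu (U `\` B))%E); last by rewrite add0e.
  by apply: leeD => //; rewrite le_eqVlt; apply/orP; left; apply/eqP; exact: B0.
(* The intervals recorded in P lie in the open set U of measure less than d that
   contains all bad points; they pay for the increments of phi across those. *)
pose P x := exists N (s t : 'I_N -> R), [/\ (forall i, a <= s i /\ s i <= t i /\ t i <= x),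
   (forall i j, i != j -> t i <= s j \/ t j <= s i),
   ((\sum_(i < N) (t i - s i))%:E <= mu (U `&` `]a, x]))%E &
   phi x - phi a <= F x - F a + e1 * (x - a) + \sum_(i < N) `|phi (t i) - phi (s i)|].
have : P b.
  apply: (@interval_induction P a b ab).
    exists 0%N, (fun=> 0), (fun=> 0); split => [[]//|[]//||].
      by rewrite big_ord0; exact: measure_ge0.
    by rewrite big_ord0 !subrr mulr0 !addr0.
  move=> s sab; have [Us|nUs] := pselect (U s).
    have [dd dd0 ddU] : exists2 dd : R, 0 < dd & ball s dd `<=` U.
      by have := oU; rewrite openE => /(_ s Us) /nbhs_ballP [dd /= ? ?]; exists dd.
    exists dd => // u v au su us sv vs vb [N [s' [t' [H1 H2 H3 H4]]]].
    have uv : u <= v by exact: le_trans sv.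
    exists N.+1, (fun i => oapp s' u (unlift ord0 i)), (fun i => oapp t' v (unlift ord0 i)).
    split.
    - move=> i; case: unliftP => [j _|_] /=; last by rewrite au uv lexx.
      by have [? [? ?]] := H1 j; do !split=> //; exact: le_trans uv.
    - move=> i j; case: (unliftP ord0 i) => [i' ->|->]; case: (unliftP ord0 j) => [j' ->|->] //=.
      + by rewrite (inj_eq (@lift_inj _ _)) => /H2.
      + by move=> _; left; have [_ [_]] := H1 i'.
      + by move=> _; right; have [_ [_]] := H1 j'.
    - rewrite big_ord_recl /= unlift_none /=.
      under eq_bigr do rewrite liftK /=.
      rewrite EFinD addeC.
      apply: (@le_trans _ _ (mu (U `&` `]a, u]) + mu (`]u, v]))%E).
        apply: leeD => //; rewrite lebesgue_measure_itv /= lte_fin.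
        by case: ltP => //; rewrite lee_fin subr_le0.
      have mUi w : measurable (U `&` `]a, w]) by exact: measurableI.
      rewrite -measureU //=; [|exact: mUi|]; last first.
        apply/seteqP; split => // x /= [[_]]; rewrite !in_itv /= => /andP[_ xu].
        by rewrite ltNge xu.
      apply: (@le_measure _ _ _ mu); rewrite ?inE; [by apply: measurableU; [exact: mUi|exact: measurable_itv]|exact: mUi|].
      move=> x /= [[Ux]|]; rewrite !in_itv /= => /andP[ax xu].
        by split=> //; rewrite ax (le_trans xu uv).
      split; last by rewrite (le_lt_trans au ax) xu.
      by apply: ddU; rewrite -ball_normE /= ltr_distlC; apply/andP; split; lra.
    - rewrite big_ord_recl /= unlift_none /=.
      under eq_bigr do rewrite liftK /=.
      have := Fnd _ _ uv; have := ler_norm (phi v - phi u).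
      have : e1 * (u - a) <= e1 * (v - a) by rewrite ler_wpM2l ?lerB // ltW.
      lra.
  have [] : (derivable F s 1 /\ 'D_1 F s = Df s) /\
   (a <= s <= b -> derivable phi s 1 /\ `|'D_1 phi s| <= Df s).
    by apply: contrapT => Hs; apply: nUs; apply: BU; apply: BP.
  move=> [dF DF] /(_ sab) [dphi Dphi].
  (* The term in e1 makes the derivative of psi positive at good points. *)
  pose psi x := F x + e1 * x - phi x.
  have dpsi : is_derive s 1 psi (Df s + e1 - 'D_1 phi s).
    have := derivableP dphi; have := derivableP dF; rewrite DF => ? ?.
    apply: is_deriveB; apply: is_deriveD.
    rewrite -[e1 in is_derive _ _ _ e1]mulr1; exact: is_deriveZ.
  have [||dd dd0 [psiv psiu]] := @derive_gt0_local psi s.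
  - exact: ex_derive.
  - rewrite derive_val subr_gt0; move: Dphi => /ler_normlP[_] /le_lt_trans; apply.
    by rewrite ltrDl.
  exists dd => // u v au su us sv vs vb [N [s' [t' [H1 H2 H3 H4]]]].
  have uv : u <= v by exact: le_trans sv.
  exists N, s', t'; split => //.
  - by move=> i; have [? [? ?]] := H1 i; do !split=> //; exact: le_trans uv.
  - apply: le_trans H3 _; apply: le_measure; rewrite ?inE; [exact: measurableI..|].
    apply: setIS; apply: subset_itvl; by rewrite bnd_simp.
  - have := psiv v sv vs; have := psiu u su us; rewrite /psi; lra.
move=> [N [s [t [H1 H2 H3 H4]]]].
have : \sum_(i < N) `|phi (t i) - phi (s i)| < e / 2.
  apply: acd => //.
  rewrite -lte_fin; apply: le_lt_trans Ud; apply: le_trans H3 _.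
  apply: le_measure; rewrite ?inE //; exact: measurableI.
have : e1 * (b - a) <= e / 2.
  rewrite /e1 -mulrA ger_pMr ?divr_gt0 // mulrC ler_pdivrMr // mul1r lerDl //.
lra.
Qed.

(** The integral of a nonnegative function is the supremum of the
    integrals of the simple functions below it, hence monotone on all
    functions; this is applied to the speed of a horizontal path, about whose
    measurability nothing is assumed. *)
Lemma ge0_le_integral_nonmeasurable (D : set R) (f1 f2 : R -> \bar R) :
  (forall x, D x -> (0 <= f1 x)%E) -> (forall x, D x -> (f1 x <= f2 x)%E) ->
  (\int[mu]_(x in D) f1 x <= \int[mu]_(x in D) f2 x)%E.
Proof.
move=> f10 f12.
rewrite !ge0_integralE //; last by move=> x Dx; exact: le_trans (f10 x Dx) (f12 x Dx).
apply: le_ereal_sup => _ /= [h hf1 <-]; exists h => // x.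
apply: le_trans (hf1 x) _.
by rewrite /patch; case: ifPn => // /set_mem; exact: f12.
Qed.

Definition clamp (a b t : R) : R := Num.max a (Num.min t b).

Lemma clamp_itv (a b t : R) : a <= b -> a <= clamp a b t <= b.
Proof. by move=> ab; rewrite /clamp le_max lexx /= ge_max ab ge_min lexx orbT. Qed.

Lemma clampK (a b t : R) : a <= t <= b -> clamp a b t = t.
Proof. by move=> /andP[at_ tb]; rewrite /clamp (min_idPl tb) (max_idPr at_). Qed.

Lemma clamp_lipschitz (a b s t : R) : `|clamp a b s - clamp a b t| <= `|s - t|.
Proof.
have key u v : u <= v -> 0 <= clamp a b v - clamp a b u <= v - u.
  rewrite /clamp => uv.
  have [ub|bu] := leP u b; have [vb|bv] := leP v b.
  - by have [|] := leP a u; have [|] := leP a v => *; apply/andP; split; lra.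
  - by have [|] := leP a u; have [|] := leP a b => *; apply/andP; split; lra.
  - by exfalso; lra.
  - by have [|] := leP a b => *; apply/andP; split; lra.
have [st|/ltW ts] := leP s t.
  by have /andP[h0 h1] := key _ _ st; rewrite distrC (distrC s) !ger0_norm ?subr_ge0 // -subr_ge0.
by have /andP[h0 h1] := key _ _ ts; rewrite !ger0_norm ?subr_ge0 // -subr_ge0.
Qed.

Lemma ac_on_opp (a b : R) (phi : R -> R) : ac_on a b phi -> ac_on a b (\- phi).
Proof.
move=> acphi e /acphi[d d0 dP]; exists d => // N s t st disj lt_d.
under eq_bigr do rewrite /= -opprD normrN; exact: dP.
Qed.

Lemma ac_on_clamp_continuous (a b : R) (phi : R -> R) : a <= b -> ac_on a b phi ->
  continuous (phi \o clamp a b).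
Proof.
move=> ab acphi x; apply/cvgrPdist_lt => e e0.
have [d d0 dP] := acphi e e0.
have key u v : a <= u -> u <= v -> v <= b -> v - u < d -> `|phi v - phi u| < e.
  move=> au uv vb uvd.
  have := dP 1%N (fun=> u) (fun=> v); rewrite !big_ord1; apply => //.
  by move=> i j; rewrite !ord1.
apply: filterS (nbhsx_ballx x _ d0) => y; rewrite -ball_normE /= => xy.
have /andP[ax xb] := clamp_itv a b x ab; have /andP[ay yb] := clamp_itv a b y ab.
have := le_lt_trans (clamp_lipschitz a b x y) xy.
have [cxy|/ltW cxy] := leP (clamp a b y) (clamp a b x).
  by rewrite ger0_norm ?subr_ge0 //; exact: key.
by rewrite distrC ger0_norm ?subr_ge0 // (distrC (phi _)); exact: key.
Qed.

(** [ac_monotone_estimate] with F the primitive of the size of the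
    derivative of phi, whose derivative is known by Lebesgue's theorem.  The
    integral of g is a lower integral, for which it is enough to compare g with
    measurable functions below it. *)
Lemma ac_estimate (phi g : R -> R) (a b C l : R) : a <= b -> ac_on a b phi -> 0 < C ->
  (forall t, 0 <= g t) ->
  {ae mu, forall t, a <= t <= b -> derivable phi t 1 /\ `|'D_1 phi t| <= C * g t} ->
  (\int[mu]_(t in `[a, b]) (g t)%:E <= l%:E)%E ->
  `|phi b - phi a| <= C * l.
Proof.
move=> ab acphi C0 g0 phiae gl.
have [B [mB B0 BP]] := phiae.
pose A := `]a, b[ `\` B.
have mA : measurable A by exact: measurableD.
have Agood t : A t -> [/\ a < t < b, derivable phi t 1 & `|'D_1 phi t| <= C * g t].
  rewrite /A /= in_itv /= => -[/andP[at_ tb] nBt].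
  have H : a <= t <= b -> derivable phi t 1 /\ `|'D_1 phi t| <= C * g t.
    by apply: contrapT => H; apply: nBt; exact: BP.
  by have [|dphi Dphi] := H; [rewrite !ltW|rewrite at_ tb].
(* The derivative is cut off outside a measurable set of full measure: there it is
   a limit of difference quotients, hence measurable, and it stays below C * g
   at every point, which is what comparing integrals with that of g requires. *)
pose f := (fun t => `|'D_1 phi t|) \_ A.
have f0 t : 0 <= f t by rewrite /f patchE; case: ifP.
have mf : measurable_fun setT f.
  apply/(measurable_restrictT _ _).1 => //.
  apply: (@measurable_fun_cvg _ _ R A
    (fun (n : nat) (t : R) => `|n.+1%:R * (phi (clamp a b (t + n.+1%:R^-1)) - phi (clamp a b t))|)).
    move=> n; apply: measurable_funTS; apply: measurableT_comp => //.
    apply: measurable_funM => //; apply: measurable_funB.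
      apply: continuous_measurable_fun.
      have : continuous ((phi \o clamp a b) \o (fun t => t + n.+1%:R^-1)).
        move=> x; apply: continuous_comp; last exact: ac_on_clamp_continuous.
        by apply: cvgD; [exact: cvg_id|exact: cvg_cst].
      exact.
    apply: continuous_measurable_fun; exact: ac_on_clamp_continuous.
  move=> t /Agood[/andP[at_ tb] dphi _]; apply: cvg_norm.
  apply/cvgrPdist_lt => e e0; have /cvgrPdist_lt /(_ _ e0) := dphi.
  move=> -[d /= d0 dP].
  have m0 : 0 < Num.min d (b - t) by rewrite lt_min d0 subr_gt0.
  have := near_infty_natSinv_lt (PosNum m0); apply: filterS => n /=.
  rewrite lt_min => /andP[nd nbt].
  have n0 : 0 < n.+1%:R^-1 :> R by rewrite invr_gt0.
  rewrite !clampK ?(ltW at_) ?(ltW tb) //; last first.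
    by rewrite (le_trans (ltW at_)) ?lerDl ?ltW //= -ltrBrDl.
  have := dP n.+1%:R^-1; rewrite /ball_ /= sub0r normrN gtr0_norm // => /(_ nd).
  by rewrite gt_eqF // invrK => /(_ isT); rewrite [n.+1%:R^-1 *: 1]mulr1 [n.+1%:R^-1 + t]addrC.
have fAS t : f t != 0 -> `[a, b]%classic t.
  rewrite /f patchE; case: ifPn => [/set_mem/Agood[/andP[at_ tb] _ _] _|]; last by rewrite eqxx.
  by rewrite /= in_itv /= !ltW.
have If : (\int[mu]_t (f t)%:E <= (C * l)%:E)%E.
  have -> : (\int[mu]_t (f t)%:E = \int[mu]_(t in `[a, b]) (C%:E * (f t / C)%:E))%E.
    rewrite [RHS]integral_mkcond; apply: eq_integral => t _; rewrite patchE.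
    case: ifPn => [_|/negP nab]; first by rewrite -EFinM mulrCA divff ?mulr1 ?gt_eqF.
    by apply/eqP; rewrite eqe; apply/negPn/negP => /fAS /mem_set.
  rewrite ge0_integralZl_EFin //=; [|by move=> t _; rewrite lee_fin divr_ge0 // ltW| |exact: ltW].
    rewrite EFinM lee_pmul2l ?fin_numE //; apply: le_trans gl.
    apply: ge0_le_integral_nonmeasurable => t _; rewrite lee_fin; first by rewrite divr_ge0 // ltW.
    rewrite ler_pdivrMr // mulrC /f patchE; case: ifPn => [/set_mem/Agood[]//|_].
    by rewrite mulr_ge0 // ltW.
  by apply: measurable_funTS; apply/measurable_EFinP; exact: measurable_funM.
have intf : mu.-integrable setT (EFin \o f).
  apply/integrableP; split; first exact/measurable_EFinP.
  under eq_integral do rewrite /= ger0_norm //.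
  exact: le_lt_trans If (ltry _).
have intfy y : mu.-integrable `]-oo, y] (EFin \o f) by exact: integrableS intf.
pose F x := (\int[mu]_(t in `]-oo, x]) f t)%R.
have Fnd : {homo F : x y / x <= y}.
  move=> x y xy; apply: fine_le; [exact: integrable_fin_num (intfy x)|exact: integrable_fin_num (intfy y)|].
  apply: ge0_subset_integral => //.
  - by apply: measurable_funTS; exact/measurable_EFinP.
  - by move=> t _; rewrite lee_fin.
  - by apply: subset_itvl; rewrite bnd_simp.
have Fae : {ae mu, forall t, derivable F t 1 /\ 'D_1 F t = f t}.
  have := @FTC1Ny R f intfy (open_integrable_locally openT intf).
  by apply: negligibleS => t /=; apply: contra_not; rewrite derive1E.
have Fl : F b - F a <= C * l.
  rewrite lerBlDr; apply: ler_wpDr; first by apply: Rintegral_ge0.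
  rewrite -lee_fin fineK; last exact: integrable_fin_num (intfy b).
  apply: le_trans If; apply: ge0_subset_integral => //.
  - exact/measurable_EFinP.
  - by move=> t _; rewrite lee_fin.
have key psi : ac_on a b psi ->
    (forall t, derivable phi t 1 -> derivable psi t 1 /\ `|'D_1 psi t| = `|'D_1 phi t|) ->
    psi b - psi a <= F b - F a.
  move=> acpsi dpsi; apply: (@ac_monotone_estimate psi F f a b) => //.
  have n1 (x : R) : mu.-negligible [set x] by exists [set x]; split => //; exact: lebesgue_measure_set1.
  have nB : mu.-negligible B by exists B; split; [exact: mB|exact: B0|].
  apply: negligibleS (negligibleU nB (negligibleU (n1 a) (n1 b))) => t /=.
  apply: contra_notP => /not_orP[nBt /not_orP[ta tb]] /andP[at_ bt].
  have At : A t.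
    split => //; rewrite /= in_itv /= !lt_neqAle at_ bt !andbT eq_sym.
    by apply/andP; split; apply/eqP.
  have [_ dphi _] := Agood _ At; have [? ->] := dpsi t dphi; split => //.
  by rewrite /f patchE mem_set.
rewrite ler_norml; apply/andP; split; last first.
  by apply: le_trans Fl; apply: key => // t; split.
rewrite lerNl; apply: le_trans Fl.
have := key (\- phi) (ac_on_opp _ _ _ acphi).
rewrite /= opprK opprB addrC; apply=> t dphi; split; first exact: derivableN.
by rewrite deriveN // normrN.
Qed.

End AbsoluteContinuity.

(** * Almost everywhere differentiability of Lipschitz curves *)

Section Rademacher.
Context {R : realType}.
Local Notation mu := (@lebesgue_measure R).

Lemma lipschitz_continuous (V W : normedModType R) (h : V -> W) (K : R) :
  (forall x y, `|h x - h y| <= K * `|x - y|) -> continuous h.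
Proof.
move=> hK x; apply/cvgrPdist_le => e e0.
have K1 : 0 < `|K| + 1 by rewrite ltr_wpDl.
have d0 : 0 < e / (`|K| + 1) by rewrite divr_gt0.
apply: filterS (nbhsx_ballx x _ d0) => y; rewrite -ball_normE /= => /ltW xy.
apply: le_trans (hK _ _) _; move: xy.
rewrite ler_pdivlMr // => /(le_trans _); apply.
by rewrite mulrC ler_wpM2l // (le_trans (ler_norm K)) // lerDl.
Qed.

(** Covers by intervals of small total length have small total
    Stieltjes length. *)
Lemma stieltjes_lipschitz_null (h : cumulative R R) (K : R) (A : set (measurableTypeR R)) :
  0 <= K -> (forall x y, x <= y -> h y - h x <= K * (y - x)) ->
  mu A = 0%E -> lebesgue_stieltjes_measure h A = 0%E.
Proof.
move=> K0 hK A0; apply/eqP; rewrite eq_le measure_ge0 andbT.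
apply/lee_addgt0Pr => e e0; rewrite add0e.
have K1 : 0 < K + 1 by rewrite ltr_wpDl.
have e1 : 0 < e / (K + 1) by rewrite divr_gt0.
have : (mu A < (e / (K + 1))%:E)%E by rewrite A0 lte_fin.
rewrite /lebesgue_measure /lebesgue_stieltjes_measure /measure_extension.
move=> /ereal_inf_lt[_ /= [F [mF AF] <-] Fe].
apply: ereal_inf_le.
exists (\sum_(k <oo) wlength h (F k))%E; first by exists F.
apply: (@le_trans _ _ (\sum_(0 <= k <oo) (K%:E * wlength idfun (F k)))%E).
  apply: lee_nneseries => [k _ _|k _]; first exact: wlength_ge0.
  have [/= X _ XF] : ocitv (F k) by exact: mF.
  rewrite -XF !wlength_itv /= !lte_fin; case: ifPn => [/ltW X12|_]; last by rewrite mule0.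
  by rewrite -EFinB -EFinM lee_fin; exact: hK.
rewrite nneseriesZl; last by move=> k _; exact: wlength_ge0.
apply: (@le_trans _ _ (K%:E * (e / (K + 1))%:E)%E).
  by apply: lee_wpmul2l; [rewrite lee_fin|exact: ltW].
rewrite -EFinM lee_fin mulrA ler_pdivrMr // mulrC ler_wpM2l ?(ltW e0) //.
by rewrite lerDl.
Qed.

(** The Lebesgue-Stieltjes measure of h is absolutely
    continuous, so h is a primitive of its Radon-Nikodym density, to which
    Lebesgue's differentiation theorem applies.  The hypothesis on clamp, i.e.
    constancy outside [a, b], makes the measure finite. *)
Lemma nondecreasing_lipschitz_derivable_ae (h : R -> R) (K a b : R) :
  a <= b -> {homo h : x y / x <= y} -> (forall x y, `|h x - h y| <= K * `|x - y|) ->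
  (forall t, h (clamp a b t) = h t) ->
  {ae mu, forall t, derivable h t 1}.
Proof.
move=> ab hnd hK hclamp.
have hc : continuous h by exact: lipschitz_continuous hK.
pose G : cumulative R R := HB.pack h
  (isCumulative.Build R _ R h hnd (right_continuousW hc)).
pose nu0 := lebesgue_stieltjes_measure G.
have nuE x y : x <= y -> nu0 `]x, y]%classic = (h y - h x)%:E.
  move=> xy; rewrite /nu0 /lebesgue_stieltjes_measure /measure_extension.
  rewrite measurable_mu_extE /=; last exact: is_ocitv.
  by rewrite wlength_itv_bnd.
have mab : measurable (`]a, b]%classic : set (measurableTypeR R)) by exact: measurable_itv.
have nuoo : (nu0 `]a, b]%classic < +oo)%E by rewrite nuE // ltry.
pose nu : {finite_measure set (measurableTypeR R) -> \bar R} := mfrestr mab nuoo.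
have ba x : nu `]-oo, x]%classic = (h x - h a)%:E.
  have /andP[ax xb] := clamp_itv a b x ab.
  rewrite /nu /= /mfrestr /mrestr -(hclamp x) -nuE //; congr nu0.
  rewrite /clamp in ax xb *; apply/seteqP; split=> t /=; rewrite !in_itv /= le_max le_min.
    by move=> [tx /andP[-> tb]]; rewrite tx tb orbT.
  move=> /andP[at_ /orP[ta|/andP[tx tb]]]; first by rewrite ltNge ta in at_.
  by rewrite tx tb at_.
have numu : nu `<< mu.
  apply/null_content_dominatesP => A mA A0.
  rewrite /nu /= /mfrestr /mrestr.
  apply: (@stieltjes_lipschitz_null G K).
  - by have := hK 1 0; rewrite subr0 normr1 mulr1; apply: le_trans.
  - by move=> x y xy; have := hK y x; rewrite !ger0_norm ?subr_ge0 // ?hnd.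
  - apply: (@subset_measure0 _ _ _ mu _ A) => //; exact: measurableI.
have [f [f0 ffin intf nuf]] := @radon_nikodym_sigma_finite _ _ _ mu nu numu.
pose g x := fine (f x).
have fE : f = EFin \o g by apply/funext => x; rewrite /g /= fineK.
have intfy y : mu.-integrable `]-oo, y] (EFin \o g).
  by rewrite -fE; exact: integrableS intf.
(* Since h is constant outside [a, b], its increments are the integrals of the
   density g over half-lines. *)
pose F x := (\int[mu]_(t in `]-oo, x]) g t)%R.
have FE x : F x = h x - h a.
  by rewrite /F /Rintegral -[RHS]/(fine (h x - h a)%:E) -ba nuf // fE.
have intf' : mu.-integrable setT (EFin \o g) by rewrite -fE.
have := @FTC1Ny R g intfy (open_integrable_locally openT intf').
apply: negligibleS => t /=; apply: contra_not => -[dF _].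
have -> : h = F \+ cst (h a) by apply/funext => x /=; rewrite FE subrK.
exact: derivableD.
Qed.

Lemma lipschitz_derivable_ae (g : R -> R) (K a b : R) : a <= b -> 0 <= K ->
  (forall x y, a <= x <= b -> a <= y <= b -> `|g x - g y| <= K * `|x - y|) ->
  {ae mu, forall t, a < t < b -> derivable g t 1}.
Proof.
move=> ab K0 gK; pose c := clamp a b.
have cab t : a <= c t <= b by exact: clamp_itv.
have cnd s t : s <= t -> c s <= c t.
  move=> st; rewrite /c /clamp ge_max !le_max lexx /= orbC.
  by rewrite le_min !ge_min lexx st !orbT.
(* Adding K * c t makes the function nondecreasing without affecting
   differentiability inside the interval. *)
pose h t := g (c t) + K * c t.
have hnd : {homo h : x y / x <= y}.
  move=> x y xy; have := gK _ _ (cab y) (cab x); have := cnd _ _ xy => cxy.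
  rewrite [X in _ * X]ger0_norm ?subr_ge0 // => /ler_normlP[].
  by rewrite /h opprB mulrBr; lra.
have hK x y : `|h x - h y| <= (K + K) * `|x - y|.
  rewrite /h opprD addrACA -mulrBr (le_trans (ler_normD _ _)) // mulrDl lerD //.
    apply: le_trans (gK _ _ (cab x) (cab y)) _.
    by rewrite ler_wpM2l //; exact: clamp_lipschitz.
  by rewrite normrM ger0_norm // ler_wpM2l //; exact: clamp_lipschitz.
have hc t : h (clamp a b t) = h t by rewrite /h /c clampK // clamp_itv.
have := nondecreasing_lipschitz_derivable_ae h _ a b ab hnd hK hc.
apply: negligibleS => t /=; apply: contra_not => dh /andP[at_ tb].
have : derivable (h - (fun t => K * t)) t 1.
  by apply: derivableB => //; apply: derivableM => //; exact: derivable_id.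
apply: near_eq_derivable; near=> s; rewrite /h /c fctE /= clampK ?addrK //.
rewrite !ltW //; near: s.
  exact: lt_nbhsl.
exact: lt_nbhsr.
Unshelve. all: by end_near.
Qed.

Lemma rV_lipschitz_derivable_ae (n : nat) (g : R -> 'rV[R]_n) (K a b : R) : a <= b -> 0 <= K ->
  (forall x y, a <= x <= b -> a <= y <= b -> `|g x - g y| <= K * `|x - y|) ->
  {ae mu, forall t, a < t < b -> derivable g t 1}.
Proof.
move=> ab K0 gK.
have gi (i : 'I_n) : {ae mu, forall t, a < t < b -> derivable (fun s => g s 0 i) t 1}.
  apply: (@lipschitz_derivable_ae _ K) => // x y xab yab.
  apply: le_trans (gK _ _ xab yab).
  apply: le_trans (ler_rV_norm _ (g x - g y) i).
  by rewrite !mxE.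
have := @negligible_bigcup _ _ _ mu (fun k => if insub k is Some i then
  ~` [set t : R | a < t < b -> derivable (fun s => g s 0 (i : 'I_n)) t 1] else set0).
case=> [k|B [mB B0 BP]].
  by case: insub => [i|]; [exact: gi|exact: negligible_set0].
exists B; split => // t /= nt; apply: BP.
have [i ni] : exists i : 'I_n, ~ (a < t < b -> derivable (fun s => g s 0 i) t 1).
  apply/existsNP => H; apply: nt => tab; apply/derivable_mxP => i j.
  by rewrite ord1; exact: H.
by exists (nat_of_ord i) => //; rewrite valK.
Qed.

End Rademacher.

(** * Functions with continuous partial derivatives *)

Section C1.
Context {R : realType}.

Definition has_C1_partials (m : nat) (F : 'rV[R]_m -> R) : Prop :=
  forall i, (forall x, derivable F x (evec R i)) /\
            continuous (fun x => 'D_(evec R i) F x).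

Lemma is_derive_line (V W : normedModType R) (F : V -> W) (x v : V) (t : R) :
  derivable F (x + t *: v) v ->
  is_derive t (1 : R) (fun s => F (x + s *: v)) ('D_v F (x + t *: v)).
Proof.
move=> dF.
have E : (fun h : R => h^-1 *: (F (x + (h *: 1 + t) *: v) - F (x + t *: v))) =
         (fun h => h^-1 *: ((F \o shift (x + t *: v)) (h *: v) - F (x + t *: v))).
  apply/funext => h /=; congr (_ *: (F _ - _)).
  by rewrite scalerDl [_ *: 1]mulr1 addrCA.
by split; rewrite /derivable /derive /= E.
Qed.

(** The mean value theorem on a line parallel to an axis.  The sign condition
    on th says that the intermediate point lies between the two ends. *)
Lemma partial_mvt (m : nat) (F : 'rV[R]_m -> R) (k : 'I_m) (x : 'rV[R]_m) (s : R) :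
  (forall x, derivable F x (evec R k)) ->
  exists2 th, `|th| <= `|s| /\ 0 <= th * s &
    F (x + s *: evec R k) - F x = 'D_(evec R k) F (x + th *: evec R k) * s.
Proof.
move=> dF; pose f t := F (x + t *: evec R k).
pose df t := 'D_(evec R k) F (x + t *: evec R k).
have fd (t : R) : is_derive t (1 : R) f (df t) by apply: is_derive_line.
have fc : continuous f.
  by move=> t; apply: differentiable_continuous; apply/derivable1_diffP; exact: ex_derive.
have f0 : f 0 = F x by rewrite /f scale0r addr0.
have [s0|/ltW s0] := leP 0 s.
  have [|th] := @MVT_segment R f df 0 s s0 (fun t _ => fd t).
    exact: continuous_subspaceT.
  rewrite in_itv /= subr0 f0 => /andP[th0 ths] E; exists th => //.
  by split; [rewrite !ger0_norm|exact: mulr_ge0].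
have [|th] := @MVT_segment R f df s 0 s0 (fun t _ => fd t).
  exact: continuous_subspaceT.
rewrite in_itv /= sub0r f0 => /andP[ths th0] E; exists th.
  by split; [rewrite !ler0_norm // lerN2|exact: mulr_le0].
by rewrite -/(f s) -opprB E mulrN opprK.
Qed.

Lemma between_norm (a b t : R) : `|t| <= `|b - a| -> 0 <= t * (b - a) ->
  `|a + t| <= Num.max `|a| `|b|.
Proof.
move=> tba t_ba; set M := Num.max _ _.
have /ler_normlP[? ?] : `|a| <= M by rewrite le_max lexx.
have /ler_normlP[? ?] : `|b| <= M by rewrite le_max lexx orbT.
have [ab|ba] := leP a b.
  have t0 : 0 <= t.
    have [//|t0] := leP 0 t; move: t_ba; rewrite nmulr_rge0 // => ba.
    have E : b - a = 0 by apply/eqP; rewrite eq_le ba subr_ge0.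
    by move: tba t0; rewrite E normr0 normr_le0 => /eqP ->; rewrite ltxx.
  have {}tba : t <= b - a by move: tba; rewrite !ger0_norm ?subr_ge0.
  by rewrite ler_norml; apply/andP; split; lra.
have t0 : t <= 0.
  by have [//|t0] := leP t 0; move: t_ba; rewrite pmulr_rge0 // subr_ge0 leNgt ba.
have {}tba : - t <= a - b by move: tba; rewrite (ler0_norm t0) ltr0_norm ?subr_lt0 // opprB.
by rewrite ler_norml; apply/andP; split; lra.
Qed.

(** Moves from x to y one coordinate at a time, with a mean value point for
    each move. *)
Lemma C1_increment (m : nat) (F : 'rV[R]_m -> R) (x y : 'rV[R]_m) :
  has_C1_partials m F ->
  exists2 xi : 'I_m -> 'rV[R]_m,
    forall k, `|xi k - x| <= `|y - x| /\ `|xi k| <= Num.max `|x| `|y| &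
    F y - F x = \sum_k 'D_(evec R k) F (xi k) * (y 0 k - x 0 k).
Proof.
move=> F1; pose z (k : nat) : 'rV[R]_m := \row_i (if (i < k)%N then y 0 i else x 0 i).
have zS (k : 'I_m) : z k.+1 = z k + (y 0 k - x 0 k) *: evec R k.
  apply/rowP => i; rewrite !mxE /= ltnS leq_eqVlt -val_eqE /= [(i == k :> nat)]eq_sym.
  case: (eqVneq (k : nat) i) => [ki|_] /=; last by rewrite mulr0 addr0.
  by rewrite ki ltnn (_ : i = k) ?mulr1 ?subrKC //; apply/val_inj.
have /choice[th thP] : forall k, exists t, (`|t| <= `|y 0 k - x 0 k| /\
    0 <= t * (y 0 k - x 0 k)) /\
    F (z k.+1) - F (z k) = 'D_(evec R k) F (z k + t *: evec R k) * (y 0 k - x 0 k).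
  move=> k; rewrite zS.
  by have [t ? ?] := @partial_mvt m F k (z k) (y 0 k - x 0 k) (F1 k).1; exists t.
have xiE (k i : 'I_m) : (z k + th k *: evec R k) 0 i =
   if (i < k)%N then y 0 i else if i == k then x 0 i + th k else x 0 i.
  rewrite !mxE /= -val_eqE /=.
  by case: ltngtP => _; rewrite /= ?mulr0 ?addr0 ?mulr1.
exists (fun k : 'I_m => z k + th k *: evec R k).
  move=> k; have [[th1 th2] _] := thP k; split; [apply: rV_norm_le => // i|apply: rV_norm_le => [|i]].
  - have yx : `|y 0 i - x 0 i| <= `|y - x| by have := ler_rV_norm _ (y - x) i; rewrite !mxE.
    have : `|(z k + th k *: evec R k) 0 i - x 0 i| <= `|y 0 i - x 0 i|.
      rewrite xiE; case: ifP => // _; case: eqP => [->|_]; last by rewrite subrr normr0.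
      by rewrite addrAC subrr add0r.
    by rewrite [(_ - x) 0 i]mxE [(- x) 0 i]mxE => /le_trans /(_ yx).
  - by rewrite le_max normr_ge0.
  - have := ler_rV_norm _ y i; have := ler_rV_norm _ x i; rewrite xiE le_max.
    case: ifP => _; first by move=> _ ->; rewrite orbT.
    case: eqP => [->|_]; last by move=> ->.
    move=> xa yb; have := between_norm _ _ _ th1 th2.
    rewrite le_max => /orP[h|h]; first by rewrite (le_trans h xa).
    by rewrite (le_trans h yb) orbT.
have zm : z m = y by apply/rowP => i; rewrite mxE ltn_ord.
have z0 : z 0%N = x by apply/rowP => i; rewrite mxE.
rewrite -(congr1 F zm) -(congr1 F z0).
rewrite -(telescope_sumr (fun k => F (z k))) // big_mkord.
by apply: eq_bigr => k _; have [_ ->] := thP k.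
Qed.

Lemma continuous_bounded_ball (m : nat) (F : 'rV[R]_m -> R) (rho : R) : continuous F ->
  exists2 K, 0 <= K & forall x, `|x| <= rho -> `|F x| <= K.
Proof.
move=> cF; have cB : compact [set x : 'rV[R]_m | `|x| <= rho].
  have [r0|r0] := ltP rho 0.
    rewrite (_ : mkset _ = set0); first exact: compact0.
    by apply/seteqP; split=> // x /= /(le_trans (normr_ge0 x)); rewrite leNgt r0.
  have := @rV_compact R m (fun=> `[- rho, rho]%classic) (fun=> @segment_compact R _ _).
  congr compact; apply/seteqP; split=> x /= xr.
    by apply: rV_norm_le => // i; have := xr i; rewrite in_itv /= ler_norml.
  by move=> i; rewrite in_itv /= -ler_norml; exact: le_trans (ler_rV_norm _ _ _) xr.
have [[x0 Bx0]|no] := pselect ([set x : 'rV[R]_m | `|x| <= rho] !=set0); last first.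
  by exists 0 => // x xr; exfalso; apply: no; exists x.
have [||c cB' cmax] := @compact_EVT_max _ R (fun x => `|F x|) [set x | `|x| <= rho] _ cB.
- by exists x0.
- by apply: continuous_subspaceT => x; apply: continuous_comp; [exact: cF|exact: norm_continuous].
by exists `|F c| => // x xr; apply: cmax; rewrite inE.
Qed.

Lemma C1_lipschitz_ball (m : nat) (F : 'rV[R]_m -> R) (rho : R) : has_C1_partials m F ->
  exists2 K, 0 <= K & forall x y, `|x| <= rho -> `|y| <= rho -> `|F x - F y| <= K * `|x - y|.
Proof.
move=> F1.
have /choice[K KP] : forall k : 'I_m, exists K, 0 <= K /\
    forall x, `|x| <= rho -> `|'D_(evec R k) F x| <= K.
  by move=> k; have [K ? ?] := continuous_bounded_ball m _ rho (F1 k).2; exists K.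
exists (\sum_k K k); first by apply: sumr_ge0 => k _; exact: (KP k).1.
move=> x y xr yr; have [xi xiP ->] := C1_increment m F y x F1.
apply: le_trans (ler_norm_sum _ _ _) _; rewrite mulr_suml; apply: ler_sum => k _.
rewrite normrM; apply: ler_pM => //; last by have := ler_rV_norm _ (x - y) k; rewrite !mxE.
apply: (KP k).2; apply: le_trans (xiP k).2 _; by rewrite ge_max xr yr.
Qed.

Lemma C1_differentiable (m : nat) (F : 'rV[R]_m -> R) (x : 'rV[R]_m) : has_C1_partials m F ->
  differentiable F x.
Proof.
move=> F1; pose df0 (v : 'rV[R]_m) := \sum_k 'D_(evec R k) F x * v 0 k.
have df0lin : linear df0.
  move=> a u v; rewrite /df0 scaler_sumr -big_split; apply: eq_bigr => k _ /=.
  by rewrite !mxE mulrDr [_ *: _]mulrA /GRing.scale /= mulrCA mulrA.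
pose df : {linear 'rV[R]_m -> R} := HB.pack df0 (GRing.isLinear.Build _ _ _ _ df0 df0lin).
have dfc : continuous df.
  apply: (@lipschitz_continuous _ _ _ _ (\sum_k `|'D_(evec R k) F x|)) => u v.
  rewrite -raddfB /= /df0; apply: le_trans (ler_norm_sum _ _ _) _.
  rewrite mulr_suml; apply: ler_sum => k _; rewrite normrM ler_wpM2l //.
  exact: ler_rV_norm.
have expn : (F : 'rV[R]_m -> R^o) \o shift x = cst (F x) + (df : 'rV[R]_m -> R^o) +o_ (0 : 'rV[R]_m) id.
  apply/eqaddoP => e e0; have m1 : 0 < m%:R + 1 :> R by rewrite ltr_wpDl.
  have e1 : 0 < e / (m%:R + 1) by rewrite divr_gt0.
  have [d d0 dP] : exists2 d : R, 0 < d & forall k y, `|y - x| < d ->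
      `|'D_(evec R k) F y - 'D_(evec R k) F x| <= e / (m%:R + 1).
    have : \forall y \near x, forall k, `|'D_(evec R k) F x - 'D_(evec R k) F y| <= e / (m%:R + 1).
      apply: (@filter_forall _ 'I_m (fun k y => `|'D_(evec R k) F x - 'D_(evec R k) F y| <= e / (m%:R + 1)) (nbhs x)).
      by move=> k; move/cvgrPdist_le : ((F1 k).2 x); apply.
    move=> /nbhs_ballP[d /= d0 dP]; exists d => // k y xy; rewrite distrC; apply: dP.
    by rewrite -ball_normE /= distrC.
  apply: filterS (nbhsx_ballx (0 : 'rV[R]_m) _ d0) => h; rewrite -ball_normE /= sub0r normrN => hd.
  have [xi xiP xiE] := C1_increment m F x (h + x) F1.
  have -> : ((F \o shift x) - (cst (F x) + df)) h =
      \sum_k ('D_(evec R k) F (xi k) - 'D_(evec R k) F x) * h 0 k.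
    rewrite [LHS](_ : _ = F (h + x) - F x - df0 h); last by rewrite /= !fctE opprD addrA.
    rewrite xiE /df0 -sumrB; apply: eq_bigr => k _; by rewrite !mxE addrK mulrBl.
  apply: le_trans (ler_norm_sum _ _ _) _.
  apply: (@le_trans _ _ (\sum_(k < m) (e / (m%:R + 1) * `|h|))).
    apply: ler_sum => k _; rewrite normrM ler_pM //; last exact: ler_rV_norm.
    by apply: dP; have [/le_lt_trans + _] := xiP k; apply; rewrite addrK.
  rewrite sumr_const card_ord -[leLHS]mulr_natl mulrA ler_wpM2r //.
  by rewrite mulrCA ger_pMr // ler_pdivrMr // mul1r lerDl.
have E := diff_unique dfc expn.
by apply/diff_locallyP; rewrite E.
Qed.

End C1.

(** * Left-invariant fields on a Lie group *)

Section CurveCalculus.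
Context {R : realType}.

Lemma derive_comp_curve (m : nat) (F : 'rV[R]_m -> R) (g : R -> 'rV[R]_m) (t : R) :
  differentiable F (g t) -> derivable g t 1 ->
  derivable (F \o g) t 1 /\ 'D_1 (F \o g) t = 'D_('D_1 g t) F (g t).
Proof.
move=> dF dg; have dg' : differentiable g t by apply/derivable1_diffP.
have dFg : differentiable (F \o g) t by exact: differentiable_comp.
split; first exact: diff_derivable.
by rewrite [LHS]deriveE // diff_comp //= -!deriveE.
Qed.

Lemma derive_coord (m : nat) (F : 'rV[R]_m -> R) (x v : 'rV[R]_m) :
  differentiable F x -> 'D_v F x = \sum_i v 0 i * 'D_(evec R i) F x.
Proof.
move=> dF; rewrite deriveE // {1}(row_sum_delta v) linear_sum.
by apply: eq_bigr => i _; rewrite linearZ /= -deriveE.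
Qed.

Lemma derive_rV_coord (V : normedModType R) (m : nat) (F : V -> 'rV[R]_m) (x v : V) (j : 'I_m) :
  derivable F x v -> ('D_v F x) 0 j = 'D_v (fun y => F y 0 j) x.
Proof. by move=> dF; rewrite derive_mx // mxE. Qed.

Lemma derivable_rVP (V : normedModType R) (m : nat) (F : V -> 'rV[R]_m) (x v : V) :
  (forall j, derivable (fun y => F y 0 j) x v) -> derivable F x v.
Proof. by move=> dF; apply/derivable_mxP => i j; rewrite ord1. Qed.

Lemma smooth_C1 (m1 m2 : nat) (F : 'rV[R]_m1 -> 'rV[R]_m2) (j : 'I_m2) (s : seq 'I_m1) :
  smooth F -> has_C1_partials m1 (iter_partial s (fun x => F x 0 j)).
Proof.
move=> sF i; split; first by move=> x; exact: (sF j s).2.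
exact: (sF j (i :: s)).1.
Qed.

End CurveCalculus.

Section LieGroup.
Context {R : realType} {n : nat}.
Variables (mul : 'rV[R]_n -> 'rV[R]_n -> 'rV[R]_n) (inv : 'rV[R]_n -> 'rV[R]_n).
Hypothesis lg : is_lie_group mul inv.

Let M (j : 'I_n) (z : 'rV[R]_(n + n)) : R := mul (lsubmx z) (rsubmx z) 0 j.
Let W (i j : 'I_n) : 'rV[R]_(n + n) -> R := 'D_(evec R (rshift n i)) (M j).

Lemma mul_C1 j : has_C1_partials _ (M j).
Proof. exact: (smooth_C1 _ _ _ j [::] (lg_smooth_mul lg)). Qed.

Lemma mul_partial_C1 i j : has_C1_partials _ (W i j).
Proof. exact: (smooth_C1 _ _ _ j [:: rshift n i] (lg_smooth_mul lg)). Qed.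

Lemma mulE p x j : mul p x 0 j = M j (row_mx p x).
Proof. by rewrite /M row_mxKl row_mxKr. Qed.

Lemma mulVKmul p x : mul p (mul (inv p) x) = x.
Proof. by rewrite (lg_mulA lg) (lg_mulxV lg) (lg_mul0x lg). Qed.

Lemma row_mx_dist (p x q y : 'rV[R]_n) (r : R) : `|p - q| <= r -> `|x - y| <= r ->
  `|row_mx p x - row_mx q y| <= r.
Proof.
move=> pq xy; apply: rV_norm_le; first exact: le_trans pq.
move=> i; rewrite opp_row_mx add_row_mx mxE; case: (fintype.split i) => k.
  exact: le_trans (ler_rV_norm _ _ _) pq.
exact: le_trans (ler_rV_norm _ _ _) xy.
Qed.

Lemma row_mx_norm (p x : 'rV[R]_n) (r : R) : `|p| <= r -> `|x| <= r -> `|row_mx p x| <= r.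
Proof.
by move=> pr xr; have := row_mx_dist p x 0 0 r; rewrite row_mx0 !subr0; apply.
Qed.

Lemma mulr_partial p x i j :
  derivable (fun y => mul p y 0 j) x (evec R i) /\
  'D_(evec R i) (fun y => mul p y 0 j) x = W i j (row_mx p x).
Proof.
have E : (fun h : R => h^-1 *: (((fun y => mul p y 0 j) \o shift x) (h *: evec R i) - mul p x 0 j))
       = (fun h : R => h^-1 *: ((M j \o shift (row_mx p x)) (h *: evec R (rshift n i)) - M j (row_mx p x))).
  apply/funext => h /=; rewrite !mulE; congr (_ *: (M j _ - _)).
  apply/rowP => k; rewrite !mxE; case: fintype.splitP => l kl; rewrite ?mxE.
    rewrite -[k == _]val_eqE /= kl ltn_eqF ?mulr0 ?add0r //.
    by rewrite ltn_addr.
  by rewrite -[k == _]val_eqE /= kl eqn_add2l.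
have := (mul_C1 j (rshift n i)).1 (row_mx p x).
by rewrite /W /derivable /derive E.
Qed.

Lemma continuous_row_mx (p : 'rV[R]_n) : continuous (fun x : 'rV[R]_n => row_mx p x).
Proof.
apply: (@lipschitz_continuous _ _ _ _ 1) => x y; rewrite mul1r.
by apply: row_mx_dist; rewrite ?subrr ?normr0.
Qed.

Lemma mulr_C1 p j : has_C1_partials _ (fun x => mul p x 0 j).
Proof.
move=> i; split => [x|]; first exact: (mulr_partial p x i j).1.
have -> : (fun x => 'D_(evec R i) (fun y => mul p y 0 j) x) =
    W i j \o (fun x => row_mx p x).
  by apply/funext => x /=; rewrite (mulr_partial p x i j).2.
move=> x; apply: continuous_comp; first exact: continuous_row_mx.
apply: differentiable_continuous; apply: C1_differentiable; exact: mul_partial_C1.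
Qed.

Lemma mulr_differentiable p x j : differentiable (fun y => mul p y 0 j) x.
Proof. by apply: C1_differentiable; exact: mulr_C1. Qed.

Lemma mulr_derivable p x v : derivable (mul p) x v.
Proof. by apply: derivable_rVP => j; apply: diff_derivable; exact: mulr_differentiable. Qed.

Local Notation Xf i := (left_invariant mul (evec R i)).

Lemma left_invariantE i p j : Xf i p 0 j = W i j (row_mx p 0).
Proof.
rewrite /left_invariant derive_rV_coord; last exact: mulr_derivable.
exact: (mulr_partial p 0 i j).2.
Qed.

Lemma left_invariant0 i : Xf i 0 = evec R i.
Proof.
rewrite /left_invariant (_ : mul 0 = id) ?derive_id //.
by apply/funext => x; rewrite (lg_mul0x lg).
Qed.

(** Left translation by r after left translation by q is left
    translation by mul r q; differentiate along the curve h |-> q (h e_i). *)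
Lemma left_invariant_push r q i j :
  'D_(Xf i q) (fun x => mul r x 0 j) q = Xf i (mul r q) 0 j.
Proof.
pose g (h : R) := mul q (0 + h *: evec R i).
have g0 : g 0 = q by rewrite /g scale0r addr0 (lg_mulx0 lg).
have [dg Dg] : derivable g 0 1 /\ 'D_1 g 0 = Xf i q.
  have [] := @is_derive_line R _ _ (mul q) 0 (evec R i) 0 (mulr_derivable _ _ _).
  by rewrite scale0r addr0.
have dF : differentiable (fun x => mul r x 0 j) (g 0) by exact: mulr_differentiable.
have [_] := derive_comp_curve _ _ g 0 dF dg; rewrite g0 Dg => <-.
have -> : (fun x => mul r x 0 j) \o g =
    (fun h : R => mul (mul r q) (0 + h *: evec R i) 0 j).
  by apply/funext => h /=; rewrite /g (lg_mulA lg).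
have [_ ->] := @is_derive_line R _ _ (fun x => mul (mul r q) x 0 j) 0 (evec R i) 0
  (diff_derivable (mulr_differentiable _ _ _)).
rewrite scale0r addr0; apply: esym; apply: (derive_rV_coord _ _ (mul (mul r q))); exact: mulr_derivable.
Qed.

(** The coordinates of the fields are partial derivatives of the
    multiplication, hence are themselves Lipschitz near 0, where the frame is the
    standard basis.  The linear error is what makes vertical displacements
    quadratic in [path_displacement]. *)
Lemma left_invariant_near0 : exists2 K, 0 <= K &
  forall p i j, `|p| <= 1 -> `|Xf i p 0 j - (i == j)%:R| <= K * `|p|.
Proof.
have /choice[K KP] : forall ij : 'I_n * 'I_n, exists K, 0 <= K /\
    forall x y, `|x| <= 1 -> `|y| <= 1 -> `|W ij.1 ij.2 x - W ij.1 ij.2 y| <= K * `|x - y|.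
  move=> [i j]; have [K ? ?] := C1_lipschitz_ball _ _ 1 (mul_partial_C1 i j).
  by exists K.
exists (\sum_ij K ij); first by apply: sumr_ge0 => ij _; exact: (KP ij).1.
move=> p i j p1.
have -> : (i == j)%:R = Xf i 0 0 j :> R by rewrite left_invariant0 mxE eqxx eq_sym.
rewrite !left_invariantE.
have z1 : `|row_mx p 0 : 'rV[R]_(n + n)| <= 1 by apply: row_mx_norm; rewrite ?normr0.
have z2 : `|row_mx 0 0 : 'rV[R]_(n + n)| <= 1 by apply: row_mx_norm; rewrite ?normr0.
apply: le_trans ((KP (i, j)).2 _ _ z1 z2) _ => /=.
apply: ler_pM => //; first exact: (KP (i, j)).1.
  rewrite (bigD1 (i, j)) //= lerDl; apply: sumr_ge0 => ij _; exact: (KP ij).1.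
by apply: row_mx_dist; rewrite ?subr0 ?normr0.
Qed.

Lemma mul_lipschitz (rho : R) : exists2 K, 0 <= K &
  forall p x y, `|p| <= rho -> `|x| <= rho -> `|y| <= rho ->
    `|mul p x - mul p y| <= K * `|x - y|.
Proof.
have /choice[K KP] : forall j, exists K, 0 <= K /\
    forall x y, `|x| <= rho -> `|y| <= rho -> `|M j x - M j y| <= K * `|x - y|.
  by move=> j; have [K ? ?] := C1_lipschitz_ball _ _ rho (mul_C1 j); exists K.
exists (\sum_j K j); first by apply: sumr_ge0 => j _; exact: (KP j).1.
move=> p x y pr xr yr; apply: rV_norm_le => [|j].
  by apply: mulr_ge0 => //; apply: sumr_ge0 => j _; exact: (KP j).1.
rewrite !mxE !mulE; apply: le_trans ((KP j).2 _ _ _ _) _; try exact: row_mx_norm.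
apply: ler_pM => //; first exact: (KP j).1.
  rewrite (bigD1 j) //= lerDl; apply: sumr_ge0 => i _; exact: (KP i).1.
by apply: row_mx_dist; rewrite ?subrr ?normr0.
Qed.

Lemma inv_bounded (rho : R) : exists2 K, 0 <= K & forall p, `|p| <= rho -> `|inv p| <= K.
Proof.
have /choice[K KP] : forall j, exists K, 0 <= K /\ forall p, `|p| <= rho -> `|inv p 0 j| <= K.
  move=> j; have cinv : continuous (fun p => inv p 0 j) := (lg_smooth_inv lg j [::]).1.
  by have [K ? ?] := continuous_bounded_ball _ _ rho cinv; exists K.
exists (\sum_j K j); first by apply: sumr_ge0 => j _; exact: (KP j).1.
move=> p pr; apply: rV_norm_le => [|j]; first by apply: sumr_ge0 => j _; exact: (KP j).1.
apply: le_trans ((KP j).2 _ pr) _.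
rewrite (bigD1 j) //= lerDl; apply: sumr_ge0 => i _; exact: (KP i).1.
Qed.

(** The coordinates of v in the left-invariant frame at p: the differential
    at p of the left translation by inv p carries that frame to the standard basis
    at 0. *)
Definition frame_coord (p v : 'rV[R]_n) : 'rV[R]_n :=
  \row_j 'D_v (fun x => mul (inv p) x 0 j) p.

(** The differential of the left translation by p undoes that by inv p. *)
Lemma frame_coord_sum p v : v = \sum_i frame_coord p v 0 i *: Xf i p.
Proof.
apply/rowP => j; rewrite summxE.
pose g (h : R) := mul (inv p) (p + h *: v).
have g0 : g 0 = 0 by rewrite /g scale0r addr0 (lg_mulVx lg).
have [dg Dg] : derivable g 0 1 /\ 'D_1 g 0 = frame_coord p v.
  have [] := @is_derive_line R _ _ (mul (inv p)) p v 0 (mulr_derivable _ _ _).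
  rewrite scale0r addr0 => ? ->; split => //; apply/rowP => k.
  by rewrite mxE (derive_rV_coord _ _ (mul (inv p)) _ _ _ (mulr_derivable _ _ _)).
have dF : differentiable (fun x => mul p x 0 j) (g 0) by exact: mulr_differentiable.
have [_] := derive_comp_curve _ _ g 0 dF dg; rewrite Dg g0 derive_coord; last first.
  exact: mulr_differentiable.
have -> : (fun x => mul p x 0 j) \o g = (fun h : R => (p + h *: v) 0 j).
  by apply/funext => h /=; rewrite /g mulVKmul.
have -> : 'D_1 (fun h : R => (p + h *: v) 0 j) 0 = v 0 j.
  have [_] := @is_derive_line R _ _ (fun x : 'rV[R]_n => x 0 j) p v 0
     (diff_derivable (differentiable_coord _ _ _)).
  move=> ->; rewrite -(derive_rV_coord _ _ id) ?derive_id //; exact: derivable_id.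
move=> ->; apply: eq_bigr => i _.
by rewrite [RHS]mxE /left_invariant (derive_rV_coord _ _ (mul p) _ _ _ (mulr_derivable _ _ _)).
Qed.

Lemma frame_coord_unique p (c : 'rV[R]_n) :
  frame_coord p (\sum_i c 0 i *: Xf i p) = c.
Proof.
apply/rowP => j; rewrite mxE deriveE; last exact: mulr_differentiable.
rewrite linear_sum (eq_bigr (fun i => c 0 i * (i == j)%:R)); last first.
  move=> i _; rewrite linearZ /= -deriveE; last exact: mulr_differentiable.
  by rewrite left_invariant_push (lg_mulVx lg) left_invariant0 mxE eqxx eq_sym.
rewrite (bigD1 j) //= eqxx mulr1 big1 ?addr0 // => i /negbTE ->; exact: mulr0.
Qed.

Lemma frame_coord_bound (rho : R) : exists2 K, 0 <= K &
  forall p v, `|p| <= rho -> `|frame_coord p v| <= K * `|v|.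
Proof.
have [Ki Ki0 KiP] := inv_bounded rho.
pose rho' := Num.max rho Ki.
have /choice[K KP] : forall ij : 'I_n * 'I_n, exists K, 0 <= K /\
    forall z, `|z| <= rho' -> `|W ij.1 ij.2 z| <= K.
  move=> [i j]; have cW : continuous (W i j).
    move=> z; apply: differentiable_continuous; apply: C1_differentiable; exact: mul_partial_C1.
  by have [K ? ?] := continuous_bounded_ball _ _ rho' cW; exists K.
have S0 : 0 <= \sum_ij K ij by apply: sumr_ge0 => ij _; exact: (KP ij).1.
exists (n%:R * \sum_ij K ij); first exact: mulr_ge0.
move=> p v pr; apply: rV_norm_le => [|j]; first by apply: mulr_ge0 => //; exact: mulr_ge0.
rewrite mxE derive_coord; last exact: mulr_differentiable.
apply: le_trans (ler_norm_sum _ _ _) _.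
apply: (@le_trans _ _ (\sum_(i < n) ((\sum_ij K ij) * `|v|))); last first.
  by rewrite sumr_const card_ord -[leLHS]mulr_natl mulrA.
apply: ler_sum => i _; rewrite (mulr_partial _ _ _ _).2 normrM mulrC.
apply: ler_pM => //; last exact: ler_rV_norm.
apply: le_trans ((KP (i, j)).2 _ _) _ => /=.
  by apply: row_mx_norm; rewrite /rho' le_max ?pr ?KiP ?orbT.
rewrite (bigD1 (i, j)) //= lerDl; apply: sumr_ge0 => ij _; exact: (KP ij).1.
Qed.

End LieGroup.

(** * Horizontal paths issued from a point *)

Section EuclideanNorm.
Context {R : realType}.

Lemma enorm_ge0 (n : nat) (x : 'rV[R]_n) : 0 <= enorm x.
Proof. exact: sqrtr_ge0. Qed.

Lemma norm_le_enorm (n : nat) (x : 'rV[R]_n) : `|x| <= enorm x.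
Proof.
apply: rV_norm_le => [|i]; first exact: enorm_ge0.
rewrite -sqrtr_sqr ler_sqrt; last by apply: sumr_ge0 => j _; exact: sqr_ge0.
by rewrite (bigD1 i) //= lerDl; apply: sumr_ge0 => j _; exact: sqr_ge0.
Qed.

Lemma enorm_le (n : nat) (x : 'rV[R]_n) : enorm x <= n%:R * `|x|.
Proof.
have n0 : 0 <= n%:R * `|x| by rewrite mulr_ge0.
rewrite -[leRHS]ger0_norm // -sqrtr_sqr ler_sqrt ?sqr_ge0 // exprMn.
apply: (@le_trans _ _ (\sum_(i < n) `|x| ^+ 2)).
  apply: ler_sum => i _; rewrite -real_normK ?num_real //.
  by rewrite lerXn2r ?nnegrE //; exact: ler_rV_norm.
rewrite sumr_const card_ord -[leLHS]mulr_natl ler_wpM2r ?sqr_ge0 //.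
by rewrite -natrX ler_nat; case: n x {n0} => // m _; rewrite expnS leq_pmulr // expn_gt0.
Qed.

Lemma ac_on_comp (n : nat) (s : R -> 'rV[R]_n) (F : 'rV[R]_n -> R) (a b K : R) :
  abs_continuous a b s ->
  (forall t u, a <= t <= b -> a <= u <= b -> `|F (s t) - F (s u)| <= K * `|s t - s u|) ->
  ac_on a b (F \o s).
Proof.
move=> acs FK e e0.
have K1 : 0 < `|K| + 1 by rewrite ltr_wpDl.
have [d d0 dP] := acs (e / (`|K| + 1)) (divr_gt0 e0 K1).
exists d => // N u v uv disj /(dP N u v uv disj).
rewrite ltr_pdivlMr // => /(le_lt_trans _); apply.
rewrite mulr_suml; apply: ler_sum => i _; have [au [uvi vb]] := uv i.
apply: le_trans (FK _ _ _ _) _.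
- by rewrite (le_trans au).
- by rewrite au (le_trans uvi).
rewrite mulrC; apply: (@le_trans _ _ (`|s (v i) - s (u i)| * (`|K| + 1))).
  by rewrite ler_wpM2l // (le_trans (ler_norm K)) // lerDl.
by rewrite ler_wpM2r ?(ltW K1) //; exact: norm_le_enorm.
Qed.

Lemma abs_continuous_bounded (n : nat) (s : R -> 'rV[R]_n) (a b : R) : a <= b ->
  abs_continuous a b s -> exists rho, forall t, a <= t <= b -> `|s t| <= rho.
Proof.
move=> ab acs.
have /choice[K KP] : forall j : 'I_n, exists K, forall t, a <= t <= b -> `|s t 0 j| <= K.
  move=> j; have acj : ac_on a b ((fun x : 'rV[R]_n => x 0 j) \o s).
    apply: (@ac_on_comp _ _ _ _ _ 1) => // t u _ _; rewrite mul1r.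
    by have := ler_rV_norm _ (s t - s u) j; rewrite !mxE.
  have cj := ac_on_clamp_continuous a b _ ab acj.
  have [||c cB cmax] := @compact_EVT_max _ R (fun t => `|s (clamp a b t) 0 j|) `[a, b]%classic _ (@segment_compact _ _ _).
  - by exists a; rewrite /= in_itv /= lexx.
  - apply: continuous_subspaceT => x; apply: (@continuous_comp _ _ _ _ (fun z : R => `|z|)).
      exact: cj.
    exact: norm_continuous.
  exists `|s (clamp a b c) 0 j| => t tab.
  by have := cmax t; rewrite (clampK _ _ t tab); apply; rewrite inE /= in_itv.
exists (\sum_j `|K j|) => t tab; apply: rV_norm_le => [|j]; first exact: sumr_ge0.
apply: le_trans (KP j t tab) _; apply: le_trans (ler_norm _) _.
by rewrite (bigD1 j) //= lerDl; exact: sumr_ge0.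
Qed.

Lemma ac_on_sub (phi : R -> R) (a b w : R) : w <= b -> ac_on a b phi -> ac_on a w phi.
Proof.
move=> wb acphi e /acphi[d d0 dP]; exists d => // N s t st; apply: dP => i.
by have [? [? tw]] := st i; do !split => //; exact: le_trans wb.
Qed.

Lemma ge0_subset_integral_nonmeasurable (A B : set R) (g : R -> \bar R) :
  A `<=` B -> (forall x, (0 <= g x)%E) ->
  (\int[@lebesgue_measure R]_(x in A) g x <= \int[@lebesgue_measure R]_(x in B) g x)%E.
Proof.
move=> AB g0; rewrite integral_mkcond [leRHS]integral_mkcond.
apply: ge0_le_integral_nonmeasurable => x _; first by rewrite patchE; case: ifP.
rewrite !patchE; case: ifPn => [/set_mem/AB/mem_set -> //|_]; by case: ifP.
Qed.

End EuclideanNorm.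

Section HorizontalPaths.
Context {R : realType} {n : nat} (G : carnot_group R n).
Local Notation mul := (cg_mul G).
Local Notation inv := (cg_inv G).
Local Notation lg := (cg_lie G).
Local Notation mu := (@lebesgue_measure R).
Local Notation Xf i := (left_invariant mul (evec R i)).
Local Notation frame := (frame_coord mul inv).
Local Notation hor := (in_layer (cg_dims G) 1).

Lemma layer_sum (p c : 'rV[R]_n) : layer (cg_dims G) 1 c ->
  \sum_(i < n | hor i) c 0 i *: Xf i p = \sum_i c 0 i *: Xf i p.
Proof.
move=> cl; rewrite [RHS](bigID (fun i : 'I_n => hor i)) /= [X in _ + X]big1 ?addr0 //.
by move=> i /cl ->; rewrite scale0r.
Qed.

Lemma is_hcoord_frame p v c : is_hcoord G p v c -> c = frame p v.
Proof. by move=> [cl ->]; rewrite layer_sum // (frame_coord_unique _ _ lg). Qed.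

Lemma frame_is_hcoord p v : layer (cg_dims G) 1 (frame p v) -> is_hcoord G p v (frame p v).
Proof. by move=> fl; split => //; rewrite layer_sum //; exact: (frame_coord_sum _ _ lg). Qed.

(** The frame is free, so the coefficient vector picked in the definition of
    hnorm is the vector of frame coordinates. *)
Lemma hspace_frame p v : hspace G p v ->
  layer (cg_dims G) 1 (frame p v) /\ hnorm G p v = enorm (frame p v).
Proof.
move=> [c hc]; have fl : layer (cg_dims G) 1 (frame p v).
  by rewrite -(is_hcoord_frame _ _ _ hc); exact: hc.1.
split => //; congr enorm.
apply: (is_hcoord_frame p v).
by apply: (@xgetPex _ 0 [set c | is_hcoord G p v c]); exists c.
Qed.

Lemma hnorm_ge0 p v : 0 <= hnorm G p v.
Proof. exact: enorm_ge0. Qed.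

(** The frame coordinates of a velocity do not change under left
    translation. *)
Lemma translated_velocity (p : 'rV[R]_n) (s : R -> 'rV[R]_n) (t : R) (j : 'I_n) :
  derivable s t 1 ->
  derivable (fun u => mul p (s u) 0 j) t 1 /\
  'D_1 (fun u => mul p (s u) 0 j) t =
     \sum_i frame (s t) ('D_1 s t) 0 i * Xf i (mul p (s t)) 0 j.
Proof.
move=> ds; have dF : differentiable (fun x => mul p x 0 j) (s t).
  exact: (mulr_differentiable _ _ lg).
have [dc Dc] := derive_comp_curve _ _ s t dF ds; split; first exact: dc.
rewrite [LHS]Dc deriveE // {1}(frame_coord_sum _ _ lg (s t) ('D_1 s t)) linear_sum.
apply: eq_bigr => i _; rewrite linearZ /= -deriveE //.
by rewrite (left_invariant_push _ _ lg).
Qed.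

(** With tau = p^-1 s, the velocity of tau is a combination of the fields
    X^i(tau) whose coefficients are bounded by the speed g.  As long as tau stays in
    the unit ball, this bounds tau by C times the length; then the coordinates of
    the X^i(tau) outside the first layer are O(|tau|), whence a second factor r. *)
Lemma path_displacement (K r a b : R) (p : 'rV[R]_n) (s : R -> 'rV[R]_n) :
  0 <= K ->
  (forall p i j, `|p| <= 1 -> `|Xf i p 0 j - (i == j)%:R| <= K * `|p|) ->
  let C := n%:R * (1 + K) + 1 in
  a <= b -> horizontal_path G a b s -> s a = p ->
  (path_length G a b s <= r%:E)%E -> 0 < r -> C * r < 1 ->
  (forall t, a <= t <= b -> `|mul (inv p) (s t)| <= C * r) /\
  (forall j : 'I_n, ~~ hor j -> `|mul (inv p) (s b) 0 j| <= C * C * r * r).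
Proof.
move=> K0 XK C ab [acs hae] sa lenr r0 Cr.
have C0 : 0 < C by rewrite ltr_wpDl // mulr_ge0 // addr_ge0.
pose tau (j : 'I_n) t := mul (inv p) (s t) 0 j.
pose g t := hnorm G (s t) (derive1 s t).
have g0 t : 0 <= g t by exact: hnorm_ge0.
have [rho rhoP] := abs_continuous_bounded n s a b ab acs.
have actau j : ac_on a b (tau j).
  have [L L0 LP] := C1_lipschitz_ball _ _ rho (mulr_C1 _ _ lg (inv p) j).
  apply: (@ac_on_comp _ _ s (fun x => mul (inv p) x 0 j) a b L) => // t u tab uab.
  by apply: LP; exact: rhoP.
have tau_a : mul (inv p) (s a) = 0 by rewrite sa (lg_mulVx lg).
have vel (t : R) j : derivable s t 1 -> hspace G (s t) (derive1 s t) -> `|mul (inv p) (s t)| <= 1 ->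
   [/\ derivable (tau j) t 1, `|'D_1 (tau j) t| <= C * g t &
      ~~ hor j -> `|'D_1 (tau j) t| <= C * `|mul (inv p) (s t)| * g t].
  move=> ds hs t1; have [dt Dt] := translated_velocity (inv p) s t j ds.
  have [fl fE] := hspace_frame _ _ hs.
  have fi i : `|frame (s t) ('D_1 s t) 0 i| <= g t.
    rewrite /g fE derive1E; apply: le_trans (ler_rV_norm _ _ i) _; exact: norm_le_enorm.
  split => //.
    rewrite [X in `|X|]Dt; apply: le_trans (ler_norm_sum _ _ _) _.
    apply: (@le_trans _ _ (\sum_(i < n) ((1 + K) * g t))).
      apply: ler_sum => i _; rewrite normrM mulrC ler_pM //.
      have := XK _ i j t1; set Z := Xf _ _ _ _ => ZK.
      have -> : Z = (Z - (i == j)%:R) + (i == j)%:R by rewrite subrK.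
      apply: le_trans (ler_normD _ _) _; rewrite addrC; apply: lerD.
        by case: eqP => _; rewrite ?normr1 ?normr0.
      by apply: le_trans ZK _; rewrite -[leRHS]mulr1 ler_wpM2l.
    rewrite sumr_const card_ord -[leLHS]mulr_natl mulrA ler_wpM2r // /C lerDl //.
  move=> nj; rewrite [X in `|X|]Dt; apply: le_trans (ler_norm_sum _ _ _) _.
  apply: (@le_trans _ _ (\sum_(i < n) (K * `|mul (inv p) (s t)| * g t))).
    apply: ler_sum => i _; rewrite normrM mulrC.
    have [hi|nhi] := boolP (hor i); last first.
      rewrite -derive1E fl // normr0 mulr0; by rewrite !mulr_ge0.
    apply: ler_pM => //; have := XK _ i j t1.
    have /negbTE -> : i != j by apply: contraNN nj => /eqP <-.
    by rewrite subr0.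
  rewrite sumr_const card_ord -[leLHS]mulr_natl !mulrA ler_wpM2r // ler_wpM2r //.
  by rewrite /C mulrDr mulr1; have : 0 <= n%:R :> R by []; lra.
have lenw w : w <= b -> (\int[mu]_(t in `[a, w]) (g t)%:E <= r%:E)%E.
  move=> wb; apply: le_trans lenr; apply: ge0_subset_integral_nonmeasurable.
    by apply: subset_itvl; rewrite bnd_simp.
  by move=> x; rewrite lee_fin.
have est (w D : R) j : a <= w <= b -> 0 < D ->
    (forall t, a <= t <= w -> `|mul (inv p) (s t)| <= 1) ->
    (forall t, a <= t <= w -> derivable s t 1 -> hspace G (s t) (derive1 s t) ->
       `|'D_1 (tau j) t| <= D * g t) ->
    `|mul (inv p) (s w) 0 j| <= D * r.
  move=> /andP[aw wb] D0 t1 tD.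
  have -> : mul (inv p) (s w) 0 j = tau j w - tau j a by rewrite /tau tau_a mxE subr0.
  apply: (@ac_estimate R (tau j) g a w D r aw (ac_on_sub _ _ _ _ wb (actau j)) D0 g0); last exact: lenw.
  apply: negligibleS hae => t /=; apply: contra_not => hae /andP[at_ tw].
  have [|ds hs] := hae; first by rewrite at_ (le_trans tw).
  by have [|dt _ _] := vel t j ds hs; [apply: t1|split=> //; apply: tD]; rewrite ?at_ ?tw.
(* The bound C * r < 1 cannot be left without first entering the gap between
   C * r and 1, where the velocity estimate is still available. *)
have first t : a <= t <= b -> `|mul (inv p) (s t)| <= C * r.
  pose P w := forall t, a <= t <= w -> `|mul (inv p) (s t)| <= C * r.
  suff : P b by apply.
  apply: (@interval_induction R P a b ab).
    move=> u /andP[au ua]; have -> : u = a by apply/eqP; rewrite eq_le au ua.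
    by rewrite tau_a normr0 mulr_ge0 // ltW.
  move=> u uab.
  have cr0 : 0 < (1 - C * r) / 2 by rewrite divr_gt0 // subr_gt0.
  have [d d0 dP] : exists2 d : R, 0 < d & forall j v, `|v - u| < d ->
      `|tau j (clamp a b u) - tau j (clamp a b v)| <= (1 - C * r) / 2.
    have : \forall v \near u, forall j, `|tau j (clamp a b u) - tau j (clamp a b v)| <= (1 - C * r) / 2.
      apply: (@filter_forall _ 'I_n (fun j v => `|tau j (clamp a b u) - tau j (clamp a b v)| <= (1 - C * r) / 2) (nbhs u)).
      by move=> j; have /cvgrPdist_le := ac_on_clamp_continuous a b (tau j) ab (actau j) u; apply.
    move=> /nbhs_ballP[d /= d0 dP]; exists d => // j v uv; apply: dP.
    by rewrite -ball_normE /= distrC.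
  exists d => // x y ax ux xu uy yu yb Px w /andP[aw wy].
  have near1 z : a <= z <= y -> `|mul (inv p) (s z)| <= 1.
    move=> /andP[az zy].
    have [zx|/ltW xz] := leP z x.
      by apply: le_trans (ltW Cr); apply: Px; rewrite az zx.
    have zab : a <= z <= b by rewrite az (le_trans zy).
    have xab : a <= x <= b by rewrite ax (le_trans xu) //; case/andP: uab.
    apply: rV_norm_le => // j.
    have /(dP j) : `|z - u| < d by rewrite ltr_distlC; apply/andP; split; lra.
    have /(dP j) : `|x - u| < d by rewrite ltr_distlC; apply/andP; split; lra.
    rewrite (clampK _ _ _ zab) (clampK _ _ _ xab).
    have := le_trans (ler_rV_norm _ (mul (inv p) (s x)) j) (Px x _).
    rewrite ax lexx => /(_ isT).
    rewrite /tau !ler_norml; set A := mul _ _ _ _; set B := mul _ _ _ _; set D := mul _ _ _ _.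
    move=> /andP[? ?] /andP[? ?] /andP[? ?]; apply/andP; split; lra.
  apply: rV_norm_le => [|j]; first by rewrite mulr_ge0 // ltW.
  apply: (est w C j) => //.
  - by rewrite aw (le_trans wy).
  - by move=> z /andP[az zw]; apply: near1; rewrite az (le_trans zw).
  - move=> z /andP[az zw] ds hs; have [|//] := vel z j ds hs.
    by apply: near1; rewrite az (le_trans zw).
split=> // j nj; apply: (est b (C * C * r) j) => //.
- by rewrite ab lexx.
- by rewrite !mulr_gt0.
- by move=> t tab; apply: le_trans (ltW Cr); exact: first.
- move=> t tab ds hs.
  have t1 : `|mul (inv p) (s t)| <= 1 by apply: le_trans (ltW Cr); exact: first.
  have [_ _ /(_ nj) /le_trans] := vel t j ds hs t1; apply.
  rewrite ler_wpM2r // -mulrA ler_wpM2l ?(ltW C0) //; exact: first.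
Qed.

(** [path_displacement] for an almost minimal path.  Left invariance makes
    the constants uniform in p. *)
Lemma dcc_displacement : exists C r0 : R, [/\ 0 < C, 0 < r0 &
  forall p q r, 0 < r -> r < r0 -> (d_cc G p q < r%:E)%E ->
    `|mul (inv p) q| <= C * r /\
    forall j : 'I_n, ~~ hor j -> `|mul (inv p) q 0 j| <= C * r ^+ 2].
Proof.
have [K K0 XK] := left_invariant_near0 _ _ lg.
pose C : R := n%:R * (1 + K) + 1.
have C1 : 1 <= C by rewrite lerDr mulr_ge0 // addr_ge0.
have C0 : 0 < C by exact: lt_le_trans C1.
exists (C * C), C^-1; split; [exact: mulr_gt0|by rewrite invr_gt0|].
move=> p q r r0 rC /ereal_inf_lt[_ [a [b [s [ab hs sa sb ->]]]]] /ltW lenr.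
have Cr : C * r < 1 by rewrite mulrC -ltr_pdivlMr // mul1r.
have [h1 h2] := path_displacement K r a b p s K0 XK ab hs sa lenr r0 Cr.
rewrite -sb; split.
  apply: le_trans (h1 b _) _; first by rewrite ab lexx.
  by rewrite ler_wpM2r ?(ltW r0) // ler_peMr // ltW.
by move=> j /h2; rewrite expr2 mulrA.
Qed.

End HorizontalPaths.

(** * Contact and the Lipschitz estimate *)

Section Contact.
Context {R : realType} {n : nat} (G : carnot_group R n).
Local Notation mul := (cg_mul G).
Local Notation inv := (cg_inv G).
Local Notation lg := (cg_lie G).
Local Notation mu := (@lebesgue_measure R).
Local Notation frame := (frame_coord mul inv).

(** q - p = p (p^-1 q) - p 0, and left translations by bounded elements are
    uniformly Lipschitz on bounded sets. *)
Lemma dcc_eucl_local (rho : R) : exists C r0 : R, [/\ 0 < C, 0 < r0 &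
  forall p q r, `|p| <= rho -> 0 < r -> r < r0 -> (d_cc G p q < r%:E)%E ->
    `|q - p| <= C * r].
Proof.
have [C [r0 [C0 r00 CP]]] := dcc_displacement G.
have [K K0 KP] := mul_lipschitz _ _ lg (Num.max rho 1).
exists ((K + 1) * C), (Num.min r0 C^-1); split.
- by rewrite mulr_gt0 // ltr_wpDl.
- by rewrite lt_min r00 invr_gt0.
move=> p q r pr rpos; rewrite lt_min => /andP[rr0 rC] /(CP p q r rpos rr0)[tr _].
have t1 : `|mul (inv p) q| <= 1.
  apply: le_trans tr _; rewrite mulrC -ler_pdivlMr // mul1r; exact: ltW.
have -> : q - p = mul p (mul (inv p) q) - mul p 0.
  by rewrite (mulVKmul _ _ lg) (lg_mulx0 lg).
apply: le_trans (KP _ _ _ _ _ _) _; rewrite ?normr0 ?le_max ?pr ?t1 ?ler01 ?orbT //.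
rewrite subr0 -mulrA; apply: ler_pM => //; by rewrite lerDl.
Qed.

(** By [dcc_displacement] the coordinates of p^-1 g(t + h) outside the first
    layer are O(w^2) = o(h), so their derivatives, which are the frame coordinates
    of the velocity, vanish. *)
Lemma contact_hspace (g : R -> 'rV[R]_n) (t : R) : derivable g t 1 ->
  (forall e : R, 0 < e -> \forall h \near (0 : R)^', exists2 w : R,
     (d_cc G (g t) (g (t + h)%R) <= w%:E)%E & 0 <= w /\ w ^+ 2 <= e * `|h|) ->
  hspace G (g t) (derive1 g t).
Proof.
move=> dg small; exists (frame (g t) (derive1 g t)); apply: frame_is_hcoord => j nj.
have [C [r0 [C0 r00 CP]]] := dcc_displacement G.
rewrite mxE derive1E.
have dF : differentiable (fun x => mul (inv (g t)) x 0 j) (g t) by exact: (mulr_differentiable _ _ lg).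
have [dc <-] := derive_comp_curve _ _ g t dF dg.
set tau := _ \o g in dc *.
have tau0 : tau t = 0 by rewrite /tau /= (lg_mulVx lg) mxE.
apply/eqP; rewrite -normr_le0; apply/ler_addgt0Pl => e e0; rewrite addr0.
pose e1 := e / 4 / C.
have e10 : 0 < e1 by rewrite !divr_gt0.
have /cvgrPdist_lt /(_ (e / 2)) := dc; rewrite divr_gt0 // => /(_ isT) dcn.
have r1 : 0 < r0 ^+ 2 / (2 * e1) by rewrite divr_gt0 ?exprn_gt0 // mulr_gt0.
have : \forall h \near (0 : R)^', `|'D_1 tau t| <= e.
  near=> h.
  have h0 : h != 0 by near: h; exact: nbhs_dnbhs_neq.
  have hn0 : 0 < `|h| by rewrite normr_gt0.
  have hr : `|h| < r0 ^+ 2 / (2 * e1) by near: h; exact: dnbhs0_lt.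
  have [w dw [w0 we]] : exists2 w, (d_cc G (g t) (g (t + h)%R) <= w%:E)%E &
    0 <= w /\ w ^+ 2 <= e1 * `|h| by near: h; exact: small.
  have Dh : `|'D_1 tau t - h^-1 *: ((tau \o shift t) (h *: 1) - tau t)| < e / 2.
    by near: h.
  (* Any radius strictly above w would do, provided its square is O(e1 * `|h|). *)
  pose r := Num.sqrt (2 * e1 * `|h|).
  have eh : 0 < 2 * e1 * `|h| by apply: mulr_gt0 => //; exact: mulr_gt0.
  have rpos : 0 < r by rewrite sqrtr_gt0.
  have rsq : r ^+ 2 = 2 * e1 * `|h| by rewrite sqr_sqrtr // ltW.
  have rr0 : r < r0.
    rewrite -(@ltr_pXn2r _ 2) ?nnegrE ?(ltW rpos) ?(ltW r00) // rsq mulrC -ltr_pdivlMr //.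
    by rewrite mulr_gt0.
  have wr : w < r.
    rewrite -(@ltr_pXn2r _ 2) ?nnegrE // ?(ltW rpos) // rsq.
    apply: le_lt_trans we _; rewrite ltr_pM2r // ltr_pMl //; lra.
  have [_ /(_ j nj)] := CP (g t) (g (t + h)) r rpos rr0 (le_lt_trans dw (wr : (w%:E < r%:E)%E)).
  rewrite rsq -[mul _ _ 0 j]/(tau (t + h)) => tauh.
  have : `|h^-1 *: ((tau \o shift t) (h *: 1) - tau t)| <= e / 2.
    rewrite tau0 subr0 /= [h *: 1]mulr1 addrC normrM normfV mulrC ler_pdivrMr //.
    apply: le_trans tauh _; rewrite !mulrA ler_wpM2r // /e1.
    rewrite le_eqVlt; apply/orP; left; apply/eqP.
    by field; rewrite gt_eqF.
  move=> q2; rewrite -[X in `|X|](subrK (h^-1 *: ((tau \o shift t) (h *: 1) - tau t))).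
  apply: le_trans (ler_normD _ _) _; move/ltW: Dh => Dh.
  by rewrite [e]splitr; exact: lerD.
by case/filter_ex.
Unshelve. all: by end_near.
Qed.

(** The exceptional set is absorbed in a measurable majorant of f, so that
    only the monotonicity of the lower integral is asked of f. *)
Lemma ae_bounded_integral_le (D : set R) (f : R -> \bar R) (c : R) :
  measurable D -> 0 <= c -> (forall x, (0 <= f x)%E) ->
  {ae mu, forall x, D x -> (f x <= c%:E)%E} ->
  (\int[mu]_(x in D) f x <= c%:E * mu D)%E.
Proof.
move=> mD c0 f0 [B [mB B0 BP]].
(* The measurable majorant of f that is infinite on the exceptional set. *)
pose g (x : R) : \bar R := (c%:E + +oo * (\1_B x)%:E)%E.
have mg : measurable_fun D g.
  apply: emeasurable_funD => //; apply: measurable_funeM.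
  by apply/measurable_EFinP; exact: measurable_indic.
apply: (@le_trans _ _ (\int[mu]_(x in D) g x)%E).
  apply: ge0_le_integral_nonmeasurable => // x Dx; rewrite /g indicE.
  have [xB|xB] := boolP (x \in B); first by rewrite mule1 addey // leey.
  rewrite mule0 adde0; apply: contrapT => nle; move/negP: xB; apply.
  by apply/mem_set/BP => /(_ Dx).
rewrite (ae_eq_integral (cst c%:E)) //; first by rewrite integral_cst.
exists B; split => // x /= ng; apply: contrapT => nB; apply: ng => Dx.
by rewrite /g indicE memNset // mule0 adde0.
Qed.

(** A homeomorphism of the half-line fixes 0: otherwise the value at 0
    would be taken again between the preimages of 0 and of a larger number. *)
Lemma homeo_nonneg_small (beta : R -> R) : homeo_nonneg beta ->
  forall e, 0 < e -> exists2 d, 0 < d & forall s, 0 <= s -> s < d -> 0 <= beta s < e.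
Proof.
move=> [beta' [b1 b2 bc _]].
have inj x y : 0 <= x -> 0 <= y -> beta x = beta y -> x = y.
  by move=> x0 y0 E; rewrite -(b1 x x0).2 E (b1 y y0).2.
have b00 : beta 0 = 0.
  have [//|bn] := eqVneq (beta 0) 0.
  have bp : 0 < beta 0 by rewrite lt_neqAle eq_sym bn (b1 0 (lexx _)).1.
  have [x00 x0E] := b2 0 (lexx _); have y0 : 0 <= beta 0 + 1 by rewrite addr_ge0 // ltW.
  have [x10 x1E] := b2 _ y0.
  set x0 := beta' 0 in x00 x0E; set x1 := beta' _ in x10 x1E.
  have x0p : 0 < x0.
    by rewrite lt_neqAle x00 andbT; apply/eqP => E; move: x0E bp; rewrite -E => ->; rewrite ltxx.
  have x1p : 0 < x1.
    rewrite lt_neqAle x10 andbT; apply/eqP => E; move: x1E; rewrite -E; lra.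
  have csub a b : 0 <= a -> {within `[a, b], continuous beta}.
    move=> a0; apply: continuous_subspaceW bc => z /=; rewrite !in_itv /= andbT.
    by case/andP => /(le_trans a0).
  have [x xp xE] : exists2 x, 0 < x & beta x = beta 0.
    have [x01|/ltW x10'] := leP x0 x1.
      have [|z] := @IVT R beta x0 x1 (beta 0) x01 (csub _ _ x00).
        by rewrite x0E x1E ge_min le_max (ltW bp) lerDl ler01 orbT.
      by rewrite in_itv /= => /andP[z0 _] zE; exists z => //; exact: lt_le_trans z0.
    have [|z] := @IVT R beta x1 x0 (beta 0) x10' (csub _ _ x10).
      by rewrite x0E x1E ge_min le_max (ltW bp) lerDl ler01 !orbT.
    by rewrite in_itv /= => /andP[z0 _] zE; exists z => //; exact: lt_le_trans z0.
  by have E := inj x 0 (ltW xp) (lexx _) xE; move: xp; rewrite E ltxx.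
move=> e e0; move/subspace_continuousP : bc => /(_ 0).
rewrite /= in_itv /= lexx => /(_ isT) /cvgrPdist_lt /(_ e e0).
rewrite /prop_near1 /within /= => /nbhs_ballP[d /= d0 dP].
exists d => // s s0 sd; rewrite (b1 s s0).1 /=.
have := dP s; rewrite -ball_normE /= sub0r normrN ger0_norm // => /(_ sd).
rewrite in_itv /= andbT => /(_ s0) bs; have : `|beta 0 - beta s| < e by exact: bs.
by rewrite b00 sub0r normrN ger0_norm // (b1 s s0).1.
Qed.

Lemma powR_sqr_le (q alpha : R) : 2^-1 <= alpha -> 0 <= q -> q <= 1 ->
  (q `^ alpha) ^+ 2 <= q.
Proof.
move=> ha; rewrite le_eqVlt => /orP[/eqP <- _|q0 q1].
  rewrite powR0 ?expr0n //; apply/eqP => a0; move: ha; rewrite a0; lra.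
rewrite -powR_mulrn ?powR_ge0 // -powRrM.
by apply: ge1r_powR; [rewrite q0|lra].
Qed.

Lemma derive1_lipschitz_le (m : nat) (g : R -> 'rV[R]_m) (K t : R) :
  derivable g t 1 -> (forall s u, `|g s - g u| <= K * `|s - u|) -> `|derive1 g t| <= K.
Proof.
move=> dg gK; apply/ler_addgt0Pl => e e0; rewrite derive1E.
have /cvgrPdist_le /(_ e e0) := dg => dn.
have : \forall h \near (0 : R)^', `|'D_1 g t| <= e + K.
  near=> h; have h0 : h != 0 by near: h; exact: nbhs_dnbhs_neq.
  have Dh : `|'D_1 g t - h^-1 *: ((g \o shift t) (h *: 1) - g t)| <= e by near: h.
  rewrite -[X in `|X|](subrK (h^-1 *: ((g \o shift t) (h *: 1) - g t))).
  apply: le_trans (ler_normD _ _) (lerD Dh _).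
  rewrite normrZ normfV mulrC ler_pdivrMr ?normr_gt0 //=.
  by apply: le_trans (gK _ _) _; rewrite [h *: 1]mulr1 addrK.
by case/filter_ex.
Unshelve. all: by end_near.
Qed.

(** The image by f of a segment is a horizontal path by [contact_hspace],
    of speed at most a constant times the length of the segment. *)
Lemma lipschitz_dcc (k : nat) (S : set 'rV[R]_k) (f : 'rV[R]_k -> 'rV[R]_n) (alpha rho : R) :
  1 / 2%:R <= alpha ->
  (forall a b t, S a -> S b -> 0 <= t <= 1 -> S (a + t *: (b - a))) ->
  holder_plus (d_cc G) alpha S f ->
  lipschitz_map (@d_eucl R n) S f ->
  (forall x, S x -> `|f x| <= rho) ->
  lipschitz_map (d_cc G) S f.
Proof.
move=> halpha convS [beta hbeta fbeta] [L L0 fL] frho.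
have [K K0 KP] := frame_coord_bound _ _ lg rho.
exists (n%:R * K * L); first by rewrite !mulr_ge0.
move=> a b Sa Sb; pose D := enorm (a - b).
have D0 : 0 <= D by exact: enorm_ge0.
(* Clamping makes the curve Lipschitz on the whole line, so that difference
   quotients are bounded on both sides of every point. *)
pose g (t : R) := f (a + clamp 0 1 t *: (b - a)).
have c01 (t : R) : 0 <= clamp 0 1 t <= 1 by exact: clamp_itv.
have Sg t : S (a + clamp 0 1 t *: (b - a)) by exact: convS.
have enormZ (m : nat) (c : R) (x : 'rV[R]_m) : enorm (c *: x) = `|c| * enorm x.
  rewrite /enorm -sqrtr_sqr -sqrtrM ?sqr_ge0 // mulr_sumr; congr Num.sqrt.
  by apply: eq_bigr => i _; rewrite mxE exprMn.
have dist t u : enorm (a + clamp 0 1 t *: (b - a) - (a + clamp 0 1 u *: (b - a))) =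
    `|clamp 0 1 t - clamp 0 1 u| * D.
  rewrite opprD addrACA subrr add0r -scalerBl enormZ; congr (_ * _).
  by rewrite -opprB -scaleN1r enormZ normrN normr1 mul1r.
have gL t u : enorm (g t - g u) <= L * D * `|t - u|.
  have := fL _ _ (Sg t) (Sg u); rewrite /d_eucl lee_fin dist => /le_trans; apply.
  rewrite mulrA mulrAC ler_wpM2l ?mulr_ge0 //; exact: clamp_lipschitz.
have gL' t u : `|g t - g u| <= L * D * `|t - u|.
  by apply: le_trans (gL t u); exact: norm_le_enorm.
have LD0 : 0 <= L * D by exact: mulr_ge0.
have gae := rV_lipschitz_derivable_ae n g (L * D) 0 1 ler01 LD0 (fun x y _ _ => gL' x y).
have good t : 0 < t < 1 -> derivable g t 1 ->
    hspace G (g t) (derive1 g t) /\ hnorm G (g t) (derive1 g t) <= n%:R * K * (L * D).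
  move=> /andP[t0 t1] dg.
  have hs : hspace G (g t) (derive1 g t).
    apply: contact_hspace => // e e0.
    have D1 : 0 < D + 1 by rewrite ltr_wpDl.
    have e1 : 0 < e / (D + 1) by rewrite divr_gt0.
    have [|d d0 dP] := homeo_nonneg_small beta hbeta (Num.sqrt (e / (D + 1))).
      by rewrite sqrtr_gt0.
    near=> h; pose q := `|h| * D.
    have q0 : 0 <= q by exact: mulr_ge0.
    have hd : `|h| < d / (D + 1) by near: h; apply: dnbhs0_lt; exact: divr_gt0.
    have h1 : `|h| < 1 / (D + 1) by near: h; apply: dnbhs0_lt; exact: divr_gt0.
    have ht : `|h| < Num.min t (1 - t) by near: h; apply: dnbhs0_lt; rewrite lt_min t0 subr_gt0.
    have qd : q < d.
      move: hd; rewrite ltr_pdivlMr //; apply: le_lt_trans.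
      by rewrite ler_wpM2l // lerDl.
    have q1 : q <= 1.
      move: h1; rewrite ltr_pdivlMr // => /ltW; apply: le_trans.
      by rewrite ler_wpM2l // lerDl.
    have th : 0 <= t + h <= 1.
      move: ht; rewrite lt_min !ltr_norml => /andP[/andP[? ?] /andP[? ?]].
      by apply/andP; split; lra.
    have qE : enorm (a + clamp 0 1 t *: (b - a) - (a + clamp 0 1 (t + h) *: (b - a))) = q.
      by rewrite dist !clampK ?(ltW t0) ?(ltW t1) // opprD addrA subrr add0r normrN.
    have /andP[b0 be] := dP q q0 qd.
    exists (q `^ alpha * beta q).
      by have := fbeta _ _ (Sg t) (Sg (t + h)); rewrite qE.
    split; first by rewrite mulr_ge0 // powR_ge0.
    rewrite exprMn; apply: (@le_trans _ _ (q * (e / (D + 1)))).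
      apply: ler_pM; rewrite ?sqr_ge0 //.
        by apply: powR_sqr_le => //; move: halpha; rewrite mul1r.
      by rewrite -(sqr_sqrtr (ltW e1)) lerXn2r ?nnegrE ?sqrtr_ge0 // ltW.
    rewrite /q -mulrA mulrC ler_wpM2r // mulrCA ger_pMr //.
    by rewrite ler_pdivrMr // mul1r lerDl.
  split => //; have [_ ->] := hspace_frame _ _ _ hs.
  apply: le_trans (enorm_le _ _) _; rewrite -mulrA ler_wpM2l //.
  apply: le_trans (KP _ _ (frho _ (Sg t))) _; rewrite ler_wpM2l //.
  exact: derive1_lipschitz_le.
have bad0 : {ae mu, forall t, 0 <= t <= 1 -> 0 < t < 1 /\ derivable g t 1}.
  have n1 (x : R) : mu.-negligible [set x] by exists [set x]; split => //; exact: lebesgue_measure_set1.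
  apply: negligibleS (negligibleU gae (negligibleU (n1 0) (n1 1))) => t /=.
  apply: contra_notP => /not_orP[/contrapT dg /not_orP[t0 t1]] /andP[t0' t1'].
  have t01 : 0 < t < 1.
    by rewrite !lt_neqAle t0' t1' !andbT eq_sym; apply/andP; split; apply/eqP.
  by split => //; exact: dg.
have hor : horizontal_path G 0 1 g.
  split; last first.
    apply: negligibleS bad0 => t /=; apply: contra_not => H /H[t01 dg].
    by split => //; exact: (good t t01 dg).1.
  move=> e e0; have LD1 : 0 < L * D + 1 by rewrite ltr_wpDl.
  exists (e / (L * D + 1)); first exact: divr_gt0.
  move=> N s t st _; rewrite ltr_pdivlMr // => /(le_lt_trans _); apply.
  rewrite mulr_suml; apply: ler_sum => i _; apply: le_trans (gL _ _) _.
  have [_ [sti _]] := st i; rewrite ger0_norm ?subr_ge0 // mulrC.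
  by rewrite ler_wpM2l ?subr_ge0 // lerDl.
apply: le_trans (ereal_inf_lbound _) (_ : (path_length G 0 1 g <= _)%E).
  exists 0, 1, g; split => //.
  - by rewrite /g clampK ?lexx ?ler01 // scale0r addr0.
  - by rewrite /g clampK ?lexx ?ler01 // scale1r addrC subrK.
have -> : (n%:R * K * L * D)%:E = ((n%:R * K * (L * D))%:E * mu `[0%R, 1%R])%E.
  by rewrite lebesgue_measure_itv /= lte_fin ltr01 sube0 mule1 !mulrA.
apply: ae_bounded_integral_le => //; first by rewrite !mulr_ge0.
  by move=> x; rewrite lee_fin; exact: hnorm_ge0.
apply: negligibleS bad0 => t /=; apply: contra_not => H.
rewrite in_itv /= => /H[t01 dg]; rewrite lee_fin; exact: (good t t01 dg).2.
Unshelve. all: by end_near.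
Qed.

End Contact.

(** * The non-existence theorem *)

Theorem theorem1p6 (R : realType) (alpha : R) (halpha : 1 / 2%:R <= alpha)
    (k : nat) (hk : (0 < k)%N)
    (Omega : set 'rV[R]_k) (Omega_open : open Omega) (Omega_neq0 : Omega !=set0)
    (n : nat) (G : carnot_group R n) (hstep : (step G <= 3)%N)
    (hG : purely_unrectifiable G k) :
  ~ exists f : 'rV[R]_k -> 'rV[R]_n,
      [/\ set_inj Omega f,
          holder_plus (d_cc G) alpha Omega f
        & locally_lipschitz_map (@d_eucl R n) Omega f].
Proof.
move=> [f [f_inj [beta hbeta fbeta] f_lip]].
have [x0 Ox0] := Omega_neq0.
have [U Ux0 [L L0 fL]] := f_lip x0 Ox0.
have /nbhs_ballP[rho0 /= rho00 ballOU] : nbhs x0 (Omega `&` U).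
  by apply: filterI => //; move: Omega_open; rewrite openE; exact.
pose S : set 'rV[R]_k := ball x0 rho0.
have SOU x : S x -> (Omega `&` U) x by exact: ballOU.
have dist_le x y : S x -> S y -> `|f x - f y| <= L * (k%:R * `|x - y|).
  move=> Sx Sy; apply: le_trans (norm_le_enorm _ _) _.
  have := fL _ _ (SOU _ Sx) (SOU _ Sy); rewrite /d_eucl lee_fin => /le_trans; apply.
  by rewrite ler_wpM2l //; exact: enorm_le.
have Sx0 : S x0 by exact: ballxx.
pose rho := `|f x0| + L * (k%:R * rho0).
have frho x : S x -> `|f x| <= rho.
  move=> Sx; rewrite -(subrK (f x0) (f x)) addrC; apply: le_trans (ler_normD _ _) _.
  rewrite lerD2l; apply: le_trans (dist_le _ _ Sx Sx0) _.
  rewrite !ler_wpM2l //; move: Sx; rewrite /S -ball_normE /= distrC; exact: ltW.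
have convS a b (t : R) : S a -> S b -> 0 <= t <= 1 -> S (a + t *: (b - a)).
  rewrite /S -ball_normE /= => Sa Sb /andP[t0 t1].
  have -> : x0 - (a + t *: (b - a)) = (1 - t) *: (x0 - a) + t *: (x0 - b).
    by apply/rowP => i; rewrite !mxE; ring.
  apply: le_lt_trans (ler_normD _ _) _; rewrite !normrZ !ger0_norm ?subr_ge0 //.
  have [->|tn0] := eqVneq t 0; first by rewrite subr0 mul1r mul0r addr0.
  have tp : 0 < t by rewrite lt_neqAle eq_sym tn0.
  have : t * `|x0 - b| < t * rho0 by rewrite ltr_pM2l.
  have : (1 - t) * `|x0 - a| <= (1 - t) * rho0 by rewrite ler_wpM2l ?subr_ge0 // ltW.
  lra.
have [Lc Lc0 fLc] : lipschitz_map (d_cc G) S f.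
  apply: (@lipschitz_dcc R n G k S f alpha rho) => //.
  - by exists beta => // a b Sa Sb; apply: fbeta; [exact: (SOU _ Sa).1|exact: (SOU _ Sb).1].
  - by exists L => // x y Sx Sy; apply: fL; exact: SOU.
have [C [r0 [C0 r00 CP]]] := dcc_eucl_local G rho.
pose c := rho0 / 2; have c0 : 0 < c by rewrite divr_gt0.
pose psi (t : 'rV[R]_k) := x0 + c *: t.
have psiS t : unit_cube k t -> S (psi t).
  move=> tC; rewrite /S -ball_normE /= /psi opprD addrA subrr add0r normrN normrZ gtr0_norm //.
  have t1 : `|t| <= 1.
    by apply: rV_norm_le => // i; have /andP[? ?] := tC i; rewrite ger0_norm.
  apply: (@le_lt_trans _ _ (c * 1)); first by rewrite ler_wpM2l // ltW.
  by rewrite mulr1 ltr_pdivrMr // ltr_pMr // ltr1n.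
have psi_dist t u : `|psi t - psi u| = c * `|t - u|.
  by rewrite /psi opprD addrACA subrr add0r -scalerBr normrZ gtr0_norm.
have psi_inj t u : psi t = psi u -> t = u.
  by move/addrI/(scalerI (lt0r_neq0 c0)).
have Lk0 : 0 <= L * (k%:R * c) by rewrite !mulr_ge0 // ltW.
have [|t u tC uC|K K0 KP] := @thick_embedding R k n (f \o psi) (L * (k%:R * c)) Lk0.
- move=> t u; rewrite !inE => tC uC /= E; apply: psi_inj; apply: f_inj => //;
    rewrite inE; exact: (SOU _ (psiS _ _)).1.
- by apply: le_trans (dist_le _ _ (psiS _ tC) (psiS _ uC)) _; rewrite psi_dist !mulrA.
pose A := psi @` unit_cube k.
have H0 : hausdorff (d_cc G) k (f @` A) = 0%E.
  apply: hG; exists Lc => // _ _ [t tC <-] [u uC <-]; apply: fLc; exact: psiS.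
pose delta := r0 / 2; have delta0 : 0 < delta by rewrite divr_gt0.
pose KC := (K * C) ^+ k; have KC0 : 0 <= KC by rewrite exprn_ge0 // mulr_ge0 // ltW.
(* eps is chosen so that the covering sum of thick_embedding stays below 1. *)
pose eps := (KC + 1)^-1; have eps0 : 0 < eps by rewrite invr_gt0 ltr_wpDl.
have : (hausdorff_pre (d_cc G) k delta (f @` A) < eps%:E)%E.
  apply: (@le_lt_trans _ _ 0%E); last by rewrite lte_fin.
  by rewrite -H0; apply: ereal_sup_ubound; exists delta.
move=> /ereal_inf_lt[_ [B [fAB Bdelta ->]] Bsum].
have diam0 j : (0 <= diameter (d_cc G) (B j))%E by apply: ereal_sup_ubound; left.
pose s j := fine (diameter (d_cc G) (B j)).
have sE j : diameter (d_cc G) (B j) = (s j)%:E.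
  rewrite fineK // ge0_fin_numE //; exact: le_lt_trans (Bdelta j) (ltry _).
have s0 j : 0 <= s j by rewrite -lee_fin -sE.
have sdelta j : s j <= delta by rewrite -lee_fin -sE.
have := KP (fun j => [set t | B j (f (psi t))]) (fun j => C * s j).
have : (\sum_(0 <= j <oo) ((K * (C * s j)) ^+ k)%:E < 1)%E.
  have -> : (\sum_(0 <= j <oo) ((K * (C * s j)) ^+ k)%:E =
             KC%:E * \sum_(0 <= j <oo) diameter (d_cc G) (B j) ^+ k)%E.
    rewrite -nneseriesZl; last by move=> j _; exact: expe_ge0.
    by apply: eq_eseriesr => j _; rewrite sE -EFin_expe -EFinM -exprMn mulrA.
  apply: (@le_lt_trans _ _ (KC%:E * eps%:E)%E).
    by apply: lee_wpmul2l; [rewrite lee_fin|exact: ltW].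
  by rewrite -EFinM lte_fin ltr_pdivrMr ?mul1r ?ltrDl // ltr_wpDl.
rewrite ltNge => /negP nge1 H; apply: nge1; apply: H.
- move=> t tC; have [j _ Bj] := fAB (f (psi t)) (ex_intro2 _ _ (psi t) (ex_intro2 _ _ t tC erefl) erefl).
  by exists j.
- by move=> j; rewrite mulr_ge0 // ltW.
- move=> j t u tC uC Bt Bu.
  have dtu : (d_cc G (f (psi u)) (f (psi t)) <= (s j)%:E)%E.
    by rewrite -sE; apply: ereal_sup_ubound; right; exists (f (psi u)) => //; exists (f (psi t)).
  apply/ler_addgt0Pr => e e0.
  (* d_cc is only known to be at most s j, and dcc_eucl_local asks for a strict
     bound that is also below r0. *)
  pose r := s j + Num.min (e / C) (r0 / 4).
  have m0 : 0 < Num.min (e / C) (r0 / 4) by rewrite lt_min !divr_gt0.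
  have rpos : 0 < r by rewrite ltr_wpDl.
  have rr0 : r < r0.
    have : Num.min (e / C) (r0 / 4) <= r0 / 4 by rewrite ge_min lexx orbT.
    have := sdelta j; rewrite /r /delta; lra.
  have dr : (d_cc G (f (psi u)) (f (psi t)) < r%:E)%E.
    by apply: le_lt_trans dtu _; rewrite lte_fin ltrDl.
  apply: le_trans (CP _ _ r (frho _ (psiS _ uC)) rpos rr0 dr) _.
  rewrite /r mulrDr lerD2l mulrC -ler_pdivlMr //.
  by rewrite ge_min lexx.
Qed.
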